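(* Let $u:\mathbb{R}^n\to\mathbb{R}$ be a smooth function and let $M^n\subset\mathbb{R}^{n+1}$ be its graph. Suppose that there is $V\in\mathbb{R}^n$ such that $|\mathrm{grad}\,u-V|\in\mathcal{L}^1(\mathbb{R}^n)$, and that there is $c>0$ such that $\|\mathrm{Hess}\,u\|^2\le c\,(1+|\mathrm{grad}\,u|^2)$ on $\mathbb{R}^n$. If there exists an integer $r$ with $0\le r\le n-1$ such that the elementary symmetric functions $S_{r+1}$ and $S_{r+2}$ of the principal curvatures of $M$ do not change sign on $M$, then $M$ has relative nullity $\nu\ge n-r$ (at every point). In particular, if $S_r\neq 0$ everywhere on $M$, then the graph $M$ is foliated by hyperplanes of dimension $n-r$, i.e. by $(n-r)$-dimensional affine subspaces of $\mathbb{R}^{n+1}$.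
   Context: The graph of $u$ is $M=\{(x,u(x)):x\in\mathbb{R}^n\}\subset\mathbb{R}^{n+1}$, with the induced metric. $\mathrm{grad}\,u$ and $\mathrm{Hess}\,u$ denote the Euclidean gradient and Hessian of $u$ on $\mathbb{R}^n$, and $\mathcal{L}^1(\mathbb{R}^n)$ is the space of Lebesgue integrable functions on $\mathbb R^n$. $M$ is oriented by the unit normal field $N=\frac1W(-\mathrm{grad}\,u,1)$, $W=\sqrt{1+|\mathrm{grad}\,u|^2}$; its shape operator is $A(Y)=-\overline D_YN$ for $Y$ tangent to $M$, where $\overline D$ is the Levi-Civita connection of $\mathbb{R}^{n+1}$. For $0\le k\le n$, $S_k$ is the $k$-th elementary symmetric function of the $n$ eigenvalues of $A$, with $S_0=1$ and $S_k=0$ for $k>n$. A function does not change sign on $M$ if it is everywhere $\ge0$ or everywhere $\le0$ on $M$ (it may vanish and need not be constant). The relative nullity of $M$ at $p$ is $\nu(p)=\dim\ker A_p$. *)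

(* Defs.v *)
From HB Require Import structures.
From mathcomp Require Import all_boot all_order all_algebra.
From mathcomp Require Import all_classical all_reals all_analysis.

Set Implicit Arguments.
Unset Strict Implicit.
Unset Printing Implicit Defensive.

Import Order.TTheory GRing.Theory Num.Theory numFieldNormedType.Exports.

Local Open Scope classical_set_scope.
Local Open Scope ring_scope.

(* Lebesgue measure on n-tuples of reals, with the product Borel sigma-algebra:
   [lebesgue_tuple n.+1] is the image of [lebesgue_measure \x lebesgue_tuple n]
   under [(x, t) |-> x :: t]. *)
Section lebesgue_tuple.
Context {R : realType}.
Notation mR := (measurableTypeR R).

Definition cons_pair n (p : mR * n.-tuple mR) : n.+1.-tuple mR :=
  [tuple of p.1 :: p.2].

Lemma measurable_cons_pair n : measurable_fun setT (@cons_pair n).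
Proof. exact: (measurable_cons measurable_fst measurable_snd). Qed.

Section step.
Context (m1 : {sigma_finite_measure set mR -> \bar R}).
Context (n : nat) (m : {sigma_finite_measure set (n.-tuple mR) -> \bar R}).

Definition lebesgue_cons : set (n.+1.-tuple mR) -> \bar R :=
  pushforward (m1 \x m)%E (@cons_pair n).

Let lebesgue_cons0 : lebesgue_cons set0 = 0%E.
Proof. by rewrite /lebesgue_cons /pushforward preimage_set0 measure0. Qed.

Let lebesgue_cons_ge0 A : (0 <= lebesgue_cons A)%E.
Proof. by rewrite /lebesgue_cons /pushforward measure_ge0. Qed.

Let lebesgue_cons_sigma_additive : semi_sigma_additive lebesgue_cons.
Proof.
move=> F mF tF mUF; rewrite /lebesgue_cons /pushforward preimage_bigcup.
have mp A : measurable A -> measurable (@cons_pair n @^-1` A).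
  by move=> mA; rewrite -[X in measurable X]setTI; exact: measurable_cons_pair.
apply: measure_semi_sigma_additive.
- by move=> i; exact: mp.
- apply/trivIsetP => /= i j _ _ ij; rewrite -preimage_setI.
  by move/trivIsetP : tF => /(_ _ _ _ _ ij) ->//; rewrite preimage_set0.
- by rewrite -preimage_bigcup; exact: mp.
Qed.

HB.instance Definition _ := isMeasure.Build _ _ _ lebesgue_cons
  lebesgue_cons0 lebesgue_cons_ge0 lebesgue_cons_sigma_additive.

Let lebesgue_cons_sigma_finite : sigma_finite setT lebesgue_cons.
Proof.
pose h (t : n.+1.-tuple mR) : mR * n.-tuple mR := (thead t, [tuple of behead t]).
have hK : cancel (@cons_pair n) h.
  by case=> x t; rewrite /h /cons_pair theadE; congr pair; exact: val_inj.
have kK : cancel h (@cons_pair n) by move=> t; rewrite /h /cons_pair -tuple_eta.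
have mh : measurable_fun setT h.
  by apply/measurable_fun_pair; [exact: measurable_tnth|exact: measurable_behead].
have [F FT Foo] : sigma_finite setT (m1 \x m)%E.
  have /sigma_finiteP[F [TF ndF Foo]] := sigma_finiteT m1.
  have /sigma_finiteP[G [TG ndG Goo]] := sigma_finiteT m.
  exists (fun i => F i `*` G i).
    rewrite -setXTT TF TG predeqE => -[x y]; split.
      move=> [/= [i _ Fix] [k _ Gky]]; exists (maxn i k) => //; split.
      - by move: x Fix; exact/subsetPset/ndF/leq_maxl.
      - by move: y Gky; exact/subsetPset/ndG/leq_maxr.
    by move=> [i _ []/= ? ?]; split; exists i.
  move=> k; have [? ?] := Foo k; have [? ?] := Goo k.
  split; first exact: measurableX.
  by rewrite product_measure1E// lte_mul_pinfty// ge0_fin_numE.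
exists (fun i => h @^-1` F i).
  by rewrite -preimage_bigcup -FT preimage_setT.
move=> i; have [mF Fi] := Foo i; split.
  by rewrite -[X in measurable X]setTI; exact: mh.
rewrite /lebesgue_cons /pushforward -comp_preimage.
by rewrite (_ : h \o _ = id)//; apply/funext => p /=; rewrite hK.
Qed.

HB.instance Definition _ := Measure_isSigmaFinite.Build _ _ _ lebesgue_cons
  lebesgue_cons_sigma_finite.

End step.

Fixpoint lebesgue_tuple n : {sigma_finite_measure set (n.-tuple mR) -> \bar R} :=
  match n with
  | 0 => \d_[tuple of [::]]
  | n'.+1 => lebesgue_cons lebesgue_measure (lebesgue_tuple n')
  end.

End lebesgue_tuple.

Definition rowt (R : realType) n (t : n.-tuple R) : 'rV[R]_n :=
  \row_i tnth t i.

(* Measurability here is with respect to the Borel sigma-algebra rather than its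
   completion; [L1_Rn] is only applied to continuous functions. *)
Definition L1_Rn (R : realType) n (f : 'rV[R]_n -> R) : Prop :=
  (@lebesgue_tuple R n).-integrable setT
    (fun t : n.-tuple (measurableTypeR R) => (f (rowt t))%:E).

(* Only used with [U] open.  ['rV[R]_n] carries the sup norm; differentiability
   and continuity depend on its topology only. *)
Fixpoint Ck_on (R : realType) (V W : normedModType R) (k : nat) (U : set V)
    (f : V -> W) : Prop :=
  match k with
  | 0 => forall x, U x -> {for x, continuous f}
  | k'.+1 => (forall x, U x -> differentiable f x) /\
             (forall v, Ck_on k' U (fun x => 'D_v f x))
  end.

Definition smooth_on (R : realType) (V W : normedModType R) (U : set V)
  (f : V -> W) : Prop := forall k, Ck_on k U f.

Section graph.
Context {R : realType} {n : nat}.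
Implicit Types (u : 'rV[R]_n -> R) (x : 'rV[R]_n).

Definition sqnorm (v : 'rV[R]_n) : R := \sum_i v ord0 i ^+ 2.

Definition enorm (v : 'rV[R]_n) : R := Num.sqrt (sqnorm v).

Definition basis_vec (i : 'I_n) : 'rV[R]_n := delta_mx ord0 i.

Definition grad u x : 'rV[R]_n := \row_i 'D_(basis_vec i) u x.

Definition hess u x : 'M[R]_n :=
  \matrix_(i, j) 'D_(basis_vec i) (fun y => 'D_(basis_vec j) u y) x.

(* Squared Hilbert-Schmidt norm. *)
Definition hs_sqnorm (H : 'M[R]_n) : R := \sum_i \sum_j H i j ^+ 2.

Definition graph_map u x : 'rV[R]_(n + 1) := row_mx x (u x)%:M.

Definition graph u : set 'rV[R]_(n + 1) := range (graph_map u).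

Definition Wfun u x : R := Num.sqrt (1 + sqnorm (grad u x)).

(* The unit normal at the point [graph_map u x], as a function of [x]. *)
Definition normal u x : 'rV[R]_(n + 1) :=
  (Wfun u x)^-1 *: row_mx (- grad u x) 1%:M.

(* The shape operator [A Y = - D_Y N] of the graph at [p := graph_map u x], as a
   matrix acting on row vectors, in the basis [E_i := d(graph_map u)_x(e_i)] of
   the tangent space.  The rows of ['J (graph_map u) x] are the [E_i] and those
   of ['J (normal u) x] are the derivatives of [N] along the [E_i]; the latter
   are tangent, and right multiplication by [pinvmx ('J (graph_map u) x)] takes
   a tangent vector to its coordinates in the basis [E]. *)
Definition shape u x : 'M[R]_n :=
  - 'J (normal u) x *m pinvmx ('J (graph_map u) x).

Definition is_spectrum (A : 'M[R]_n) (l : n.-tuple R) : Prop :=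
  char_poly A = \prod_(a <- l) ('X - a%:P).

(* The principal curvatures, with multiplicity.  For smooth [u] the operator
   [shape u x] is self-adjoint for the induced metric, so that a spectrum exists
   and is unique up to order; the default value of [xget] is then irrelevant. *)
Definition principal_curvatures u x : n.-tuple R :=
  xget [tuple of nseq n 0] [set l | is_spectrum (shape u x) l].

Definition esym (k : nat) (l : n.-tuple R) : R :=
  \sum_(I : {set 'I_n} | #|I| == k) \prod_(i in I) tnth l i.

Definition S_ u (k : nat) x : R := esym k (principal_curvatures u x).

Definition no_sign_change (f : 'rV[R]_n -> R) : Prop :=
  (forall x, 0 <= f x) \/ (forall x, f x <= 0).

Definition relative_nullity u x : nat := \rank (kermx (shape u x)).

Definition affine_subspace m (d : nat) (L : set 'rV[R]_m) : Prop :=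
  exists (p : 'rV[R]_m) (B : 'M[R]_(d, m)),
    row_free B /\ L = [set p + s *m B | s in [set: 'rV[R]_d]].

Definition open_box m (a b : 'rV[R]_m) : set 'rV[R]_m :=
  [set y | forall i, a ord0 i < y ord0 i < b ord0 i].

(* A flat chart of the graph around [graph_map u x0], adapted to the family
   [F] of leaves and read in the global chart [graph_map u]: a smooth
   diffeomorphism [phi] (with inverse [psi]) from an open set [U] containing
   [x0] onto an open box of [R^(d + q)], such that each leaf meets [U] in a
   countable (possibly empty) union of slices on which the last [q] coordinates
   are constant. *)
Definition flat_chart u (d q : nat) (F : set (set 'rV[R]_(n + 1))) x0 : Prop :=
  exists (U : set 'rV[R]_n) (a b : 'rV[R]_(d + q))
         (phi : 'rV[R]_n -> 'rV[R]_(d + q)) (psi : 'rV[R]_(d + q) -> 'rV[R]_n),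
    [/\ open U /\ U x0,
        phi @` U = open_box a b /\ (forall x, U x -> psi (phi x) = x),
        smooth_on U phi /\ smooth_on (open_box a b) psi &
        forall L, F L -> exists C : set 'rV[R]_q, countable C /\
          U `&` graph_map u @^-1` L = U `&` [set x | C (rsubmx (phi x))] ].

(* [graph u] has a smooth foliation whose leaves are d-dimensional affine
   subspaces of R^(n+1). *)
Definition foliated_by_affine u (d : nat) : Prop :=
  exists F : set (set 'rV[R]_(n + 1)),
    [/\ forall L, F L -> affine_subspace d L,
        \bigcup_(L in F) L = graph u,
        trivIset F id &
        forall x0, flat_chart u d (n - d) F x0].

End graph.

(* Main.v *)
From HB Require Import structures.
Require Import Defs.
From mathcomp Require Import all_boot all_order all_algebra.
From mathcomp Require Import all_classical all_reals all_analysis.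
From mathcomp Require Import measurable_realfun perm complex ring lra.

Set Implicit Arguments.
Unset Strict Implicit.
Unset Printing Implicit Defensive.
Import Order.TTheory GRing.Theory Num.Theory numFieldNormedType.Exports.
Local Open Scope classical_set_scope.
Local Open Scope ring_scope.

(** Write [p] for the gradient of [u], [W = sqrt (1 + |p|^2)] and [G = p / W].

    In the global chart the shape operator is the Jacobian matrix of [G]
    ([shapeE]).  It factors as [W^-1 H B B], with [H] the Hessian and [B] a
    symmetric invertible matrix, hence is conjugate to the symmetric matrix
    [W^-1 B H B]: its spectrum is real and its rank is at most the number of
    nonzero eigenvalues ([slope_spectrum]).

    The symmetric functions of the eigenvalues of a Jacobian matrix are null
    Lagrangians.  Indeed [det (I + t DG) = sum_k t^k S_k], whose derivative in
    [t] is [tr (adj (I + t DG) DG)]; by Piola's identity ([piola]) the adjugate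
    is divergence free, so this trace is the divergence of
    [(G - g) adj (I + t DG)] for every constant vector [g].  Interpolating in
    [t] writes [k S_k] as the divergence of a field bounded by a multiple of
    [|G - g|] ([esym_divergence]); the multiple is a constant because the bound
    on the Hessian makes [DG] bounded.  With [g = V / sqrt (1 + |V|^2)] the
    bound becomes a multiple of [|p - V|], which is integrable.

    An integrable field whose divergence has a sign is divergence free
    ([divergence_eq0]): integrate against a cutoff whose gradient is of order
    [1 / rho].  So, for [k >= 1], a function [S_k] that does not change sign
    vanishes ([S_eq0]).  Applied to [S_(r+1)] and [S_(r+2)], this gives two
    consecutive zero coefficients of the characteristic polynomial, and a
    real-rooted polynomial with such a gap is divisible by the corresponding
    power of ['X] ([gap_coef_real_rooted]): at most [r] principal curvatures
    are nonzero.

    If moreover [S_r] has no zero, it has a constant sign by continuity, so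
    that [r >= 1] would force [S_r = 0] by the same argument.  Hence [r = 0],
    the Hessian vanishes, [u] is affine, and the foliation has the graph itself
    as its only leaf. *)

(** * Real-rooted polynomials and symmetric matrices *)

Lemma deriv_prod_XsubC_horner (F : fieldType) (s : seq F) (z : F) :
  z \notin s ->
  (\prod_(a <- s) ('X - a%:P))^`().[z] =
  (\prod_(a <- s) ('X - a%:P)).[z] * \sum_(a <- s) (z - a)^-1.
Proof.
elim: s => [|a s IH]; first by rewrite !big_nil derivC horner0 mulr0.
rewrite inE negb_or => /andP[za zs].
rewrite !big_cons derivM derivXsubC mul1r !hornerE IH //.
have : z - a != 0 by rewrite subr_eq0.
move: (horner _ _) (\sum_(j <- s) _) => P S za0; field.
exact: za0.
Qed.

(** A root [z] of [p'] that is not a root of [p] satisfies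
    [sum_a 1 / (z - a) = 0]; subtracting the conjugate equation leaves
    [(z^* - z) sum_a |z - a|^-2 = 0], and the sum is positive. *)
Lemma deriv_real_rooted_root (C : numClosedFieldType) (s : seq C) (z : C) :
  all [in Num.real] s -> s != [::] ->
  root (\prod_(a <- s) ('X - a%:P))^`() z -> z \is Num.real.
Proof.
move=> sr s0 rz.
have [zs|zs] := boolP (z \in s); first by move/allP: sr => /(_ _ zs).
have sum0 : \sum_(a <- s) (z - a)^-1 = 0.
  move: rz; rewrite rootE deriv_prod_XsubC_horner // mulf_eq0 => /orP[|/eqP//].
  by rewrite -rootE root_prod_XsubC (negbTE zs).
have sumE : \sum_(a <- s) ((z - a)^-1 - ((z - a)^-1)^* ) =
    (z^* - z) * \sum_(a <- s) `|z - a| ^- 2.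
  rewrite mulr_sumr; apply: eq_big_seq => a ax.
  have ar : a^* = a by apply/CrealP; move/allP: sr => /(_ _ ax).
  have d0 : z - a != 0 by rewrite subr_eq0; apply: contraNneq zs => ->.
  have cza : (z - a)^* = z^* - a by rewrite rmorphB /= ar.
  rewrite fmorphV /= cza normCK cza.
  have d1 : z^* - a != 0.
    rewrite subr_eq0; apply: contraNneq zs => /(congr1 Num.conj).
    by rewrite conjCK ar => ->.
  by field; rewrite d0 d1.
apply/CrealP/eqP; rewrite -subr_eq0.
have : (z^* - z) * \sum_(a <- s) `|z - a| ^- 2 == 0.
  by rewrite -sumE big_split /= sumrN -rmorph_sum sum0 rmorph0 subr0.
rewrite mulf_eq0 => /orP[//|].
case: s s0 sr zs {rz sum0 sumE} => // a s _ _ zs.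
have inv_ge0 b : 0 <= `|z - b| ^- 2 by rewrite invr_ge0 exprn_ge0.
rewrite big_cons paddr_eq0; [|exact: inv_ge0|by apply: sumr_ge0].
case/andP=> + _; rewrite invr_eq0 expf_eq0 /= normr_eq0 => /eqP/subr0_eq za.
by rewrite za inE eqxx in zs.
Qed.

(** The roots of the derivative in the algebraic closure [R[i]] are real by the
    previous lemma, so the factorization of the derivative descends to [R]. *)
Lemma deriv_real_rooted (R : rcfType) (s : seq R) : s != [::] ->
  exists s' : seq R, size s' = (size s).-1 /\
   (\prod_(a <- s) ('X - a%:P))^`() = (size s)%:R *: \prod_(a <- s') ('X - a%:P).
Proof.
move=> s0; set p := \prod_(a <- s) _.
pose f : {rmorphism R -> R[i]} := real_complex R.
have fp : map_poly f p = \prod_(a <- map f s) ('X - a%:P).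
  rewrite /p rmorph_prod big_map; apply: eq_bigr => a _.
  by rewrite rmorphB /= map_polyX map_polyC.
have [r qr] := closed_field_poly_normal (map_poly f p^`()).
have cd : p^`()`_(size s).-1 = (size s)%:R.
  rewrite coef_deriv; case: (s) s0 @p {fp qr} => // a t _ p /=.
  have := monic_prod_XsubC (a :: t) predT id; rewrite monicE lead_coefE.
  by rewrite size_prod_XsubC /= => /eqP ->.
have s0' : (size s)%:R != 0 :> R by rewrite pnatr_eq0 size_eq0.
have p0 : p != 0 by rewrite -size_poly_gt0 size_prod_XsubC.
have szd : size p^`() = size s.
  apply/eqP; rewrite eqn_leq; apply/andP; split.
    by have := lt_size_deriv p0; rewrite size_prod_XsubC ltnS.
  rewrite leqNgt; apply: contra_neqN s0' => h; rewrite -cd nth_default //.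
  by move: h; case: (size s).
have ldc : lead_coef p^`() = (size s)%:R by rewrite lead_coefE szd.
have rr : all [in Num.real] r.
  apply/allP => z zr; apply: (@deriv_real_rooted_root _ (map f s)).
  - by apply/allP => _ /mapP[a _ ->]; rewrite complex_real.
  - by case: (s) s0.
  - rewrite -fp deriv_map qr rootZ; first by rewrite root_prod_XsubC.
    by rewrite lead_coef_map ldc fmorph_eq0.
pose s' := map (@complex.Re R) r.
have fs' : map f s' = r.
  rewrite -map_comp map_id_in // => z zr /=; apply: RRe_real.
  by move/allP: rr => /(_ _ zr).
have E : p^`() = (size s)%:R *: \prod_(a <- s') ('X - a%:P).
  apply: (map_poly_inj f); rewrite qr lead_coef_map ldc.
  rewrite map_polyZ rmorph_prod -fs' big_map; congr (_ *: _).
  by apply: eq_bigr => a _; rewrite rmorphB /= map_polyX map_polyC.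
exists s'; split=> //; have := congr1 (fun q : {poly R} => size q) E.
by rewrite szd size_scale // size_prod_XsubC => ->.
Qed.

(** If all roots [a] are nonzero, the quantity is [p(0)^2 sum_a a^-2], that is
    [- p^2 (p'/p)'] at [0]; the statement in terms of coefficients survives
    zero roots, which makes the induction on [s] immediate. *)
Lemma second_coef_real_rooted (R : realFieldType) (s : seq R) :
  let p := \prod_(a <- s) ('X - a%:P) in
  0 <= p`_1 ^+ 2 - 2 * p`_0 * p`_2 /\
  (s != [::] -> p`_0 != 0 -> 0 < p`_1 ^+ 2 - 2 * p`_0 * p`_2).
Proof.
elim: s => [|a s [+ _]] /=.
  by rewrite big_nil !coefC /= expr0n /= mulr0 subr0; split.
rewrite big_cons; move: (\prod_(_ <- s) _) => q IH.
have -> : (('X - a%:P) * q)`_0 = - a * q`_0.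
  by rewrite mulrBl coefB coefXM coefCM /=; ring.
have -> : (('X - a%:P) * q)`_1 = q`_0 - a * q`_1.
  by rewrite mulrBl coefB coefXM coefCM /=; ring.
have -> : (('X - a%:P) * q)`_2 = q`_1 - a * q`_2.
  by rewrite mulrBl coefB coefXM coefCM /=; ring.
have -> : (q`_0 - a * q`_1) ^+ 2 - 2 * (- a * q`_0) * (q`_1 - a * q`_2) =
    q`_0 ^+ 2 + a ^+ 2 * (q`_1 ^+ 2 - 2 * q`_0 * q`_2) by ring.
split=> [|_ h]; first by apply: addr_ge0; [exact: sqr_ge0 | apply: mulr_ge0 IH; exact: sqr_ge0].
apply: ltr_wpDr; first by apply: mulr_ge0 IH; exact: sqr_ge0.
rewrite lt_def sqr_ge0 andbT sqrf_eq0.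
by apply: contraNneq h => ->; rewrite mulr0.
Qed.

(** Differentiating shifts the gap down, so by induction every coefficient
    below it vanishes except possibly [p`_0]; then [p`_1 = p`_2 = 0], which
    [second_coef_real_rooted] excludes unless [p`_0 = 0]. *)
Lemma gap_coef_real_rooted (R : rcfType) (j : nat) (s : seq R) :
  let p := \prod_(a <- s) ('X - a%:P) in
  (j.+1 < size s)%N -> p`_j = 0 -> p`_j.+1 = 0 ->
  forall i, (i <= j.+1)%N -> p`_i = 0.
Proof.
elim: j s => [|j IH] s p js pj pj1 i.
  by case: i => [|[|]]//.
have s0 : s != [::] by case: (s) js.
have [s' [ss' ps']] := deriv_real_rooted s0.
have n0 : (size s)%:R != 0 :> R by rewrite pnatr_eq0 size_eq0.
have cE k : (\prod_(a <- s') ('X - a%:P))`_k = (size s)%:R^-1 * (p`_k.+1 *+ k.+1).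
  by rewrite -coef_deriv ps' coefZ mulKf.
have h k : (k <= j.+1)%N -> p`_k.+1 = 0.
  move=> kj; have : (\prod_(a <- s') ('X - a%:P))`_k = 0.
    apply: (IH s') => //; rewrite ?cE ?pj ?pj1 ?mul0rn ?mulr0 //.
    by rewrite ss'; case: (size s) js.
  move/eqP; rewrite cE mulf_eq0 invr_eq0 (negbTE n0) /= mulrn_eq0 /=.
  by move/eqP.
case: i => [_|i]; last exact: h.
apply/eqP; apply: contraT => p0.
have [_ /(_ s0 p0)] := second_coef_real_rooted s.
rewrite -/p (h 0%N) // (h 1%N) //; lra.
Qed.

(** The multiplicity of the root [0] bounds the number of vanishing low-order
    coefficients. *)
Lemma coef_count_zero (R : idomainType) (s : seq R) :
  (\prod_(a <- s) ('X - a%:P))`_(count_mem 0 s) != 0.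
Proof.
suff [q -> q0] : exists2 q : {poly R},
    \prod_(a <- s) ('X - a%:P) = q * 'X^(count_mem 0 s) & q`_0 != 0.
  by rewrite coefMXn ltnn subnn.
elim: s => [|a s [q IH q0]].
  by exists 1; rewrite ?big_nil ?mulr1 // coefC /= oner_eq0.
rewrite big_cons IH /=; case: eqVneq => [->|a0].
  by exists q => //; rewrite subr0 add1n exprS mulrCA.
exists (('X - a%:P) * q); first by rewrite add0n mulrA.
by rewrite mulrBl coefB coefXM coefCM /= sub0r oppr_eq0 mulf_neq0.
Qed.

Lemma count_nonzero_real_rooted (R : rcfType) (n r : nat) (s : seq R) :
  size s = n -> (r < n)%N ->
  let p := \prod_(a <- s) ('X - a%:P) in
  p`_(n - r.+1) = 0 -> ((r.+1 < n)%N -> p`_(n - r.+2) = 0) ->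
  (count (predC1 0%R) s <= r)%N.
Proof.
move=> sn rn p p1 p2.
have vanish i : (i <= n - r.+1)%N -> p`_i = 0.
  have [rn1|rn1] := ltnP r.+1 n.
    have e : (n - r.+1 = (n - r.+2).+1)%N by rewrite subnSK.
    rewrite e; apply: gap_coef_real_rooted; rewrite ?p2 -?e //.
    by rewrite sn ltn_subrL (ltn_trans _ rn1).
  by have e : n = r.+1 by [apply/eqP; rewrite eqn_leq rn1 rn]; rewrite e subnn leqn0 => /eqP ->;
     rewrite -[in RHS]p1 e subnn.
have cz : (n - r <= count_mem 0%R s)%N.
  rewrite leqNgt; apply/negP => h; have := coef_count_zero s.
  by rewrite vanish ?eqxx // -ltnS subnSK.
have := count_predC (pred1 0%R) s; rewrite sn => nE.
rewrite -(leq_add2l (count_mem 0%R s)) nE.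
by move: cz; rewrite leq_subLR addnC.
Qed.

Lemma char_poly_similar (F : fieldType) n (P A B : 'M[F]_n) : P \in unitmx ->
  P *m A = B *m P -> char_poly A = char_poly B.
Proof.
move=> Pu PA; rewrite /char_poly.
have E : map_mx polyC P *m char_poly_mx A = char_poly_mx B *m map_mx polyC P.
  by rewrite mulmxBr mulmxBl scalar_mxC -!map_mxM PA.
have : \det (map_mx polyC P) != 0.
  by rewrite det_map_mx polyC_eq0 -unitfE -unitmxE.
by move=> h; apply: (mulfI h); rewrite -det_mulmx E det_mulmx mulrC.
Qed.

Lemma rank_diag_le (F : fieldType) n (d : 'rV[F]_n) :
  (\rank (diag_mx d) <= #|[pred i | d 0%R i != 0%R]|)%N.
Proof.
have -> : diag_mx d = \sum_(i in [pred i | d 0 i != 0]) d 0 i *: delta_mx i i.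
  rewrite diag_mx_sum_delta [LHS](bigID (fun i => d 0 i == 0)) /=.
  rewrite big1 ?add0r => [|i /eqP ->]; last by rewrite scale0r.
  by apply: eq_bigl => i; rewrite inE.
rewrite -sum1_card; elim/big_ind2: _ => [|A a B b ha hb|i _].
- by rewrite mxrank0.
- exact: leq_trans (mxrank_add _ _) (leq_add ha hb).
- by rewrite (leq_trans (mxrank_scale _ _)) // mxrank_delta.
Qed.

(** The complexification of [S] is hermitian, hence unitarily similar to a real
    diagonal matrix. *)
Lemma symmetric_spectrum (R : rcfType) n (S : 'M[R]_n) : S^T = S ->
  exists d : n.-tuple R, char_poly S = \prod_(a <- d) ('X - a%:P) /\
    (\rank S <= count (predC1 0%R) d)%N.
Proof.
move=> ST; pose f : {rmorphism R -> R[i]} := real_complex R.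
pose SC := map_mx f S.
have SH : SC \is hermsymmx.
  apply/is_hermitianmxP; rewrite expr0 scale1r; apply/matrixP => i j.
  rewrite !mxE /=; have /matrixP/(_ i j) := ST; rewrite !mxE => ->.
  by apply/esym/CrealP; rewrite complex_real.
have /mxOverP dr := hermitian_spectral_diag_real SH.
have /orthomx_spectralP := hermitian_normalmx SH.
set P := spectralmx SC; set d := spectral_diag SC in dr * => SE.
have Pu : P \in unitmx := spectral_unit SC.
have [e fe] : exists e : n.-tuple R, forall i, f (tnth e i) = d 0 i.
  exists [tuple complex.Re (d 0 i) | i < n] => i.
  by rewrite tnth_mktuple; apply: RRe_real.
exists e; split.
  apply: (map_poly_inj f); rewrite map_char_poly -/SC rmorph_prod /=.
  rewrite (@char_poly_similar _ _ P SC (diag_mx d)) //; last first.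
    by rewrite SE !mulmxA mulmxV // mul1mx.
  rewrite char_poly_trig ?diag_mx_is_trig // big_tuple; apply: eq_bigr => i _.
  by rewrite rmorphB /= map_polyX map_polyC /= mxE eqxx mulr1n -fe.
rewrite -(mxrank_map f) -/SC {1}SE mxrankMfree ?row_free_unit //.
rewrite (leq_trans (mxrankM_maxr _ _)) // (leq_trans (rank_diag_le _)) //.
rewrite -sum1_card -sum1_count big_tuple leq_eqVlt; apply/orP; left.
by apply/eqP; apply: eq_bigl => i; rewrite inE -fe fmorph_eq0.
Qed.

(** * Smooth functions *)

Notation smooth f := (smooth_on setT f).

Section Ck.
Context {R : realType} {V : normedModType R}.
Implicit Types (f g : V -> R) (k : nat).

Notation Ck k f := (Ck_on k [set: V] f).

Lemma CkS k f : Ck k.+1 f <->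
  (forall x, differentiable f x) /\ (forall v, Ck k (fun x => 'D_v f x)).
Proof.
by split=> -[df dDf]; split=> // *; exact: df.
Qed.

Lemma CkW k f : Ck k.+1 f -> Ck k f.
Proof.
elim: k f => [|k IH] f /CkS[df dDf].
  by move=> x _; exact: differentiable_continuous.
by apply/CkS; split=> // v; exact/IH/dDf.
Qed.

Lemma Ck_ext k f g : f =1 g -> Ck k f -> Ck k g.
Proof. by move=> /funext ->. Qed.

Lemma Ck_cst k (c : R) : Ck k (fun=> c).
Proof.
elim: k c => [|k IH] c; first by move=> x _; exact: cst_continuous.
apply/CkS; split=> [x|v]; first exact: differentiable_cst.
by apply: (Ck_ext (f := fun=> 0)) => // x; rewrite derive_cst.
Qed.

Lemma CkD k f g : Ck k f -> Ck k g -> Ck k (fun x => f x + g x).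
Proof.
elim: k f g => [|k IH] f g.
  by move=> cf cg x _; apply: continuousD; [exact: cf|exact: cg].
move=> /CkS[df Df] /CkS[dg Dg]; apply/CkS; split=> [x|v].
  exact: differentiableD.
apply: (Ck_ext (f := fun x => 'D_v f x + 'D_v g x)); last exact: IH.
by move=> x; rewrite -deriveD //; exact: diff_derivable.
Qed.

Lemma CkM k f g : Ck k f -> Ck k g -> Ck k (fun x => f x * g x).
Proof.
elim: k f g => [|k IH] f g.
  by move=> cf cg x _; apply: continuousM; [exact: cf|exact: cg].
move=> Cf Cg; have [df Df] := (CkS _ _).1 Cf; have [dg Dg] := (CkS _ _).1 Cg.
apply/CkS; split=> [x|v]; first exact: differentiableM.
apply: (Ck_ext (f := fun x => f x * 'D_v g x + g x * 'D_v f x)).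
  move=> x; rewrite -[RHS]/('D_v (f * g) x) deriveM //; exact: diff_derivable.
by apply: CkD; apply: IH => //; exact: CkW.
Qed.

Lemma CkV k f : (forall x, f x != 0) -> Ck k f -> Ck k (fun x => (f x)^-1).
Proof.
move=> f0; elim: k => [|k IH].
  by move=> cf x _; apply: continuousV; [exact: f0|exact: cf].
move=> Cf; have [df Df] := (CkS _ _).1 Cf.
apply/CkS; split=> [x|v]; first exact: differentiableV.
apply: (Ck_ext (f := fun x => (-1) * ((f x)^-1 * (f x)^-1) * 'D_v f x)).
  move=> x; rewrite deriveV //; last exact: diff_derivable.
  by rewrite mulN1r -invfM -expr2.
apply: CkM => //; apply: CkM; first exact: Ck_cst.
by apply: CkM; apply: IH; exact: CkW.
Qed.

Lemma diff_sqrt f x : 0 < f x -> differentiable f x ->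
  differentiable (fun x => Num.sqrt (f x)) x /\
  forall v, 'D_v (fun x => Num.sqrt (f x)) x = (2 * Num.sqrt (f x))^-1 * 'D_v f x.
Proof.
move=> fx df.
have ds := is_derive1_sqrt fx.
have d1 : differentiable (@Num.sqrt R) (f x).
  by apply/derivable1_diffP; case: ds.
have d2 : differentiable (Num.sqrt \o f) x by exact: differentiable_comp.
split=> // v; rewrite -[LHS]/('D_v (Num.sqrt \o f) x) deriveE // diff_comp //=.
rewrite deriveE // deriv1E; last by case: ds.
by rewrite derive1E derive_val; exact: mulrC.
Qed.

Lemma Ck_sqrt k f : (forall x, 0 < f x) -> Ck k f ->
  Ck k (fun x => Num.sqrt (f x)).
Proof.
move=> f0; elim: k => [|k IH].
  move=> cf x _; apply: (@continuous_comp _ _ _ f Num.sqrt); first exact: cf.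
  exact: sqrt_continuous.
move=> Cf; have [df Df] := (CkS _ _).1 Cf.
apply/CkS; split=> [x|v]; first by case: (diff_sqrt (f0 x) (df x)).
apply: (Ck_ext (f := fun x => (2 * Num.sqrt (f x))^-1 * 'D_v f x)).
  by move=> x; case: (diff_sqrt (f0 x) (df x)).
apply: CkM => //; apply: CkV => [x|]; last first.
  by apply: CkM; [exact: Ck_cst|apply: IH; exact: CkW].
by rewrite mulf_neq0 // gt_eqF // sqrtr_gt0.
Qed.

Lemma smooth_diff f x : smooth f -> differentiable f x.
Proof. by move=> /(_ 1) /CkS[]. Qed.

Lemma smooth_cont f : smooth f -> continuous f.
Proof. by move=> /(_ 0) cf x; exact: cf. Qed.

Lemma smooth_derivable f x v : smooth f -> derivable f x v.
Proof. by move=> /smooth_diff sf; exact: diff_derivable. Qed.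

Lemma smooth_derive f v : smooth f -> smooth (fun x => 'D_v f x).
Proof. by move=> sf k; have /CkS[_] := sf k.+1; exact. Qed.

Lemma smooth_is_derive f x v : smooth f -> is_derive x v f ('D_v f x).
Proof. by move=> sf; exact/derivableP/smooth_derivable. Qed.

Lemma smooth_ext f g : f =1 g -> smooth f -> smooth g.
Proof. by move=> /funext ->. Qed.

Lemma smooth_cst (c : R) : smooth (fun _ : V => c).
Proof. by move=> k; exact: Ck_cst. Qed.

Lemma smoothD f g : smooth f -> smooth g -> smooth (fun x => f x + g x).
Proof. by move=> sf sg k; exact: CkD. Qed.

Lemma smoothM f g : smooth f -> smooth g -> smooth (fun x => f x * g x).
Proof. by move=> sf sg k; exact: CkM. Qed.

Lemma smoothN f : smooth f -> smooth (fun x => - f x).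
Proof.
move=> sf; apply: (smooth_ext (f := fun x => (-1) * f x)).
  by move=> x; rewrite mulN1r.
by apply: smoothM => //; exact: smooth_cst.
Qed.

Lemma smoothV f : (forall x, f x != 0) -> smooth f -> smooth (fun x => (f x)^-1).
Proof. by move=> f0 sf k; exact: CkV. Qed.

Lemma smooth_sqrt f : (forall x, 0 < f x) -> smooth f ->
  smooth (fun x => Num.sqrt (f x)).
Proof. by move=> f0 sf k; exact: Ck_sqrt. Qed.

Lemma smooth_sum (I : Type) (r : seq I) (P : pred I) (F : I -> V -> R) :
  (forall i, P i -> smooth (F i)) -> smooth (fun x => \sum_(i <- r | P i) F i x).
Proof.
move=> sF; elim: r => [|i r IH].
  apply: (smooth_ext (f := fun=> 0)); last exact: smooth_cst.
  by move=> x; rewrite big_nil.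
case: (boolP (P i)) => Pi.
  apply: (smooth_ext (f := fun x => F i x + \sum_(j <- r | P j) F j x)).
    by move=> x; rewrite big_cons Pi.
  by apply: smoothD => //; exact: sF.
apply: smooth_ext IH => x.
by rewrite big_cons (negbTE Pi).
Qed.

Lemma smooth_prod (I : Type) (r : seq I) (P : pred I) (F : I -> V -> R) :
  (forall i, P i -> smooth (F i)) -> smooth (fun x => \prod_(i <- r | P i) F i x).
Proof.
move=> sF; elim: r => [|i r IH].
  apply: (smooth_ext (f := fun=> 1)); last exact: smooth_cst.
  by move=> x; rewrite big_nil.
case: (boolP (P i)) => Pi.
  apply: (smooth_ext (f := fun x => F i x * \prod_(j <- r | P j) F j x)).
    by move=> x; rewrite big_cons Pi.
  by apply: smoothM => //; exact: sF.
apply: smooth_ext IH => x.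
by rewrite big_cons (negbTE Pi).
Qed.

End Ck.

Lemma smooth_det (R : realType) (V : normedModType R) n (M : V -> 'M[R]_n) :
  (forall i j, smooth (fun x => M x i j)) -> smooth (fun x => \det (M x)).
Proof.
move=> sM; apply: smooth_sum => s _; apply: smoothM; first exact: smooth_cst.
by apply: smooth_prod => i _; exact: sM.
Qed.

Lemma smooth_adj (R : realType) (V : normedModType R) n (M : V -> 'M[R]_n) i j :
  (forall i j, smooth (fun x => M x i j)) -> smooth (fun x => \adj (M x) i j).
Proof.
move=> sM; apply: (smooth_ext (f := fun x => cofactor (M x) j i)).
  by move=> x; rewrite mxE.
apply: smoothM; first exact: smooth_cst.
apply: smooth_det => a b.
apply: (smooth_ext (f := fun x => M x (lift j a) (lift i b))); last exact: sM.
by move=> x; rewrite !mxE.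
Qed.

Section line.
Context {R : realType} {V : normedModType R}.
Implicit Types (f : V -> R).

Lemma is_derive_line f (x v : V) (s : R) : differentiable f (x + s *: v) ->
  is_derive s 1 (fun s => f (x + s *: v)) ('D_v f (x + s *: v)).
Proof.
move=> df.
have dl : is_diff s (fun s : R => x + s *: v) (fun s => s *: v).
  rewrite -[X in is_diff _ _ X]add0r; apply: is_diffD.
have dc : differentiable (f \o (fun s : R => x + s *: v)) s.
  by apply: differentiable_comp => //; exact: ex_diff.
apply: DeriveDef; first exact/diff_derivable.
rewrite -[LHS]/('D_1 (f \o (fun s : R => x + s *: v)) s) deriveE // diff_comp //.
  by rewrite /= diff_val scale1r deriveE.
Qed.

Lemma cont_line f (x v : V) : continuous f -> continuous (fun s : R => f (x + s *: v)).
Proof.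
move=> cf s; apply: (@continuous_comp _ _ _ (fun s : R => x + s *: v) f); last exact: cf.
by apply: continuousD; [exact: cst_continuous|exact: scalel_continuous].
Qed.

Lemma MVT_line f (x v : V) (h : R) : smooth f -> 0 < h ->
  exists2 c, 0 < c < h & f (x + h *: v) - f x = h * 'D_v f (x + c *: v).
Proof.
move=> sf h0.
have [c] := @MVT R (fun s => f (x + s *: v)) (fun s => 'D_v f (x + s *: v)) 0 h h0
  (fun s _ => is_derive_line (smooth_diff _ sf))
  (continuous_subspaceT (cont_line (smooth_cont sf))).
rewrite in_itv /= scale0r addr0 subr0 => ch E; exists c => //.
by rewrite E mulrC.
Qed.

Lemma MVT_line_diff f (x v z : V) (h : R) : smooth f -> 0 < h ->
  exists2 c, 0 < c < h &
    (f (x + z + h *: v) - f (x + h *: v)) - (f (x + z) - f x) =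
    h * ('D_v f (x + z + c *: v) - 'D_v f (x + c *: v)).
Proof.
move=> sf h0.
have [|c] := @MVT R (fun s => f (x + z + s *: v) - f (x + s *: v))
  (fun s => 'D_v f (x + z + s *: v) - 'D_v f (x + s *: v)) 0 h h0
  (fun s _ => is_deriveB (is_derive_line (smooth_diff _ sf))
                (is_derive_line (smooth_diff _ sf))).
  apply: continuous_subspaceT => s; apply: continuousB; exact/cont_line/smooth_cont.
rewrite in_itv /= scale0r !addr0 subr0 => ch E; exists c => //.
by rewrite E mulrC.
Qed.

Let close_contra (a b p q : R) : p = q -> `|q - a| < `|a - b| / 2 ->
  `|p - b| < `|a - b| / 2 -> False.
Proof.
move=> -> qa qb; have := ler_distD q a b; rewrite (distrC a q).
by rewrite leNgt [X in _ < X]splitr ltrD.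
Qed.

(** The second difference [f (x + hv + hw) - f (x + hv) - f (x + hw) + f x] is
    [h^2] times either mixed derivative, taken at points that tend to [x] with
    [h]. *)
Lemma schwarz f (v w x : V) : smooth f ->
  'D_v (fun y => 'D_w f y) x = 'D_w (fun y => 'D_v f y) x.
Proof.
move=> sf.
have key (v' w' : V) (h : R) : 0 < h -> exists c d : R, [/\ 0 < c < h, 0 < d < h &
  f (x + h *: w' + h *: v') - f (x + h *: v') - (f (x + h *: w') - f x) =
   h ^+ 2 * 'D_w' (fun y => 'D_v' f y) (x + c *: v' + d *: w')].
  move=> h0.
  have [c ch E1] := MVT_line_diff x v' (h *: w') sf h0.
  have [d dh E2] := MVT_line (x + c *: v') w' (smooth_derive v' sf) h0.
  by exists c, d; split=> //; rewrite expr2 -mulrA -E2 E1 (addrAC x).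
have near_x (g : V -> R) (v' w' : V) (e : R) : continuous g -> 0 < e ->
    \forall h \near 0^'+, forall c d : R, 0 < c < h -> 0 < d < h ->
      `|g (x + c *: v' + d *: w') - g x| < e.
  move=> cg e0.
  have cl : (fun p : R * R => g (x + p.1 *: v' + p.2 *: w')) @ ((0 : R), (0 : R)) --> g x.
    have -> : g x = g (x + (0 : R) *: v' + (0 : R) *: w').
      by rewrite !scale0r !addr0.
    apply: (@cvg_comp _ _ _ (fun p : R * R => x + p.1 *: v' + p.2 *: w') g _
      (nbhs (x + (0 : R) *: v' + (0 : R) *: w'))); last exact: cg.
    apply: cvgD; first apply: cvgD; first exact: cvg_cst.
      by apply: cvgZr_tmp; exact: cvg_fst.
    by apply: cvgZr_tmp; exact: cvg_snd.
  have /cvgrPdist_lt/(_ _ e0)/nbhs_ballP[d /= d0 H] := cl.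
  near=> h => a b /andP[a0 ah] /andP[b0 bh].
  rewrite distrC; apply: (H (a, b)); split => /=.
    rewrite /ball /= sub0r normrN gtr0_norm //.
    by apply: lt_trans ah _; near: h; exact: nbhs_right_lt.
  rewrite /ball /= sub0r normrN gtr0_norm //.
  by apply: lt_trans bh _; near: h; exact: nbhs_right_lt.
apply/eqP; rewrite -subr_eq0 -normr_eq0; apply: contraT => ne0.
have e0 : 0 < `|'D_v (fun y => 'D_w f y) x - 'D_w (fun y => 'D_v f y) x| / 2.
  by rewrite divr_gt0 // lt_def ne0 normr_ge0.
have N1 := near_x _ w v _ (smooth_cont (smooth_derive v (smooth_derive w sf))) e0.
have N2 := near_x _ v w _ (smooth_cont (smooth_derive w (smooth_derive v sf))) e0.
have [h [[h0 H1] H2]] := filter_ex (filterI (filterI (@nbhs_right_gt R 0) N1) N2).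
have [c [d [ch dh E1]]] := key v w h h0.
have [c' [d' [ch' dh' E2]]] := key w v h h0.
have xc : x + h *: v + h *: w = x + h *: w + h *: v := addrAC _ _ _.
have E : 'D_w (fun y => 'D_v f y) (x + c *: v + d *: w) =
         'D_v (fun y => 'D_w f y) (x + c' *: w + d' *: v).
  have h2 : h ^+ 2 != 0 by rewrite expf_neq0 // gt_eqF.
  apply: (mulfI h2); apply: etrans (esym E1) (etrans _ E2); rewrite xc.
  by move: (f _) (f (x + _)) (f (x + _)) (f x) => *; ring.
have B1 := H1 _ _ ch' dh'.
have B2 := H2 _ _ ch dh.
by case: (@close_contra _ _ _ _ E B1 B2).
Unshelve. all: by end_near.
Qed.

End line.

(** * Jacobi's formula and Piola's identity *)

(** The Leibniz rule in a form without division: in the [k]-th term, the [k]-th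
    factor is replaced by its derivative. *)
Lemma is_derive_prod (R : realType) (V : normedModType R) (x v : V) n
    (f : 'I_n -> V -> R) (df : 'I_n -> R) :
  (forall i, is_derive x v (f i) (df i)) ->
  is_derive x v (fun y => \prod_i f i y)
    (\sum_k \prod_i (if i == k then df i else f i x)).
Proof.
elim: n f df => [|n IH] f df hf.
  have -> : (fun y => \prod_(i < 0) f i y) = cst 1.
    by apply/funext => y; rewrite big_ord0.
  by rewrite big_ord0; exact: is_derive_cst.
have -> : (fun y => \prod_(i < n.+1) f i y) =
    f ord0 * (fun y => \prod_(i < n) f (lift ord0 i) y).
  by apply/funext => y; rewrite big_ord_recl.
have h := is_deriveM (hf ord0) (IH (fun i => f (lift ord0 i)) _ (fun i => hf (lift ord0 i))).
apply: is_derive_eq h _.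
rewrite [RHS]big_ord_recl [LHS]addrC; congr (_ + _).
  by rewrite big_ord_recl eqxx [LHS]mulrC; congr (_ * _).
by rewrite [LHS]mulr_sumr; apply: eq_bigr => k _; rewrite [RHS]big_ord_recl.
Qed.

Lemma is_derive_bigsum (R : realType) (V : normedModType R) (x v : V) (I : Type)
    (r : seq I) (f : I -> V -> R) (df : I -> R) :
  (forall i, is_derive x v (f i) (df i)) ->
  is_derive x v (fun y => \sum_(i <- r) f i y) (\sum_(i <- r) df i).
Proof.
move=> hf; elim: r => [|i r IH].
  rewrite (_ : (fun y => _) = cst 0); last by apply/funext => y; rewrite big_nil.
  by rewrite big_nil; exact: is_derive_cst.
rewrite (_ : (fun y => _) = f i + (fun y => \sum_(j <- r) f j y)).
  by rewrite big_cons; exact: is_deriveD.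
by apply/funext => y; rewrite big_cons.
Qed.

(** Jacobi's formula: by the Leibniz rule the derivative of [\det M] is the sum
    over [k] of the determinants of [M] with row [k] replaced by that of [dM],
    to be expanded along this row. *)
Lemma jacobi_det (R : realType) (V : normedModType R) (x v : V) n
    (M : V -> 'M[R]_n) (dM : 'M[R]_n) :
  (forall i j, is_derive x v (fun y => M y i j) (dM i j)) ->
  is_derive x v (fun y => \det (M y)) (\tr (\adj (M x) *m dM)).
Proof.
move=> hM.
have h : is_derive x v (fun y => \sum_(s : 'S_n) (-1) ^+ s * \prod_i M y i (s i))
   (\sum_(s : 'S_n) (-1) ^+ s *
     \sum_k \prod_i (if i == k then dM i (s i) else M x i (s i))).
  apply: is_derive_bigsum => s.
  exact: (is_deriveZ _ (is_derive_prod (fun i => hM i (s i)))).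
apply: is_derive_eq h _.
under eq_bigr do rewrite mulr_sumr.
rewrite exchange_big /= mxtrace_mulC; apply: eq_bigr => k _.
pose Mk := \matrix_(i, j) (if i == k then dM i j else M x i j).
transitivity (\det Mk).
  apply: eq_bigr => s _; congr (_ * _); apply: eq_bigr => i _.
  by rewrite mxE.
rewrite (expand_det_row _ k) mxE; apply: eq_bigr => j _.
rewrite !mxE eqxx; congr (_ * (_ * \det _)).
apply/matrixP => a b; rewrite !mxE.
by rewrite eq_sym (negbTE (neq_lift _ _)).
Qed.

(** The pointwise content of Piola's identity, for [A = adj M] and
    [d = det M].  The second hypothesis is the derivative of
    [M *m A = (\det M)%:M] in the direction [i], by Jacobi's formula.  Multiplied
    by [A], it expresses [d dA_i] by [A] and [dM_i], and the two resulting
    double sums agree because [dM_i a b] is symmetric in [i] and [a]. *)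
Lemma piola_algebra (F : comPzRingType) n (M A : 'M[F]_n) (d : F)
    (dM dA : 'I_n -> 'M[F]_n) (j : 'I_n) :
  A *m M = d%:M ->
  (forall i, dM i *m A + M *m dA i = (\tr (A *m dM i))%:M) ->
  (forall i a b, dM i a b = dM a i b) ->
  d * \sum_i dA i j i = 0.
Proof.
move=> AM dMA curl.
have E i : d *: dA i = \tr (A *m dM i) *: A - A *m dM i *m A.
  have := congr1 (mulmx A) (dMA i); rewrite mulmxDr !mulmxA AM mul_scalar_mx.
  by rewrite mul_mx_scalar => <-; rewrite addrAC subrr add0r.
have -> : d * \sum_i dA i j i = \sum_i (d *: dA i) j i.
  by rewrite mulr_sumr; apply: eq_bigr => i _; rewrite mxE.
under eq_bigr do rewrite E mxE [X in X + _]mxE [X in _ + X]mxE.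
rewrite big_split /= sumrN; apply/eqP; rewrite subr_eq0; apply/eqP.
transitivity (\sum_i \sum_a \sum_b A j a * dM i a b * A b i); last first.
  apply: eq_bigr => i _; rewrite mxE exchange_big; apply: eq_bigr => b _.
  by rewrite mxE mulr_suml.
rewrite exchange_big; apply: eq_bigr => a _ /=.
rewrite mxtrace_mulC mulr_suml; apply: eq_bigr => i _.
rewrite mxE mulr_suml; apply: eq_bigr => b _.
by rewrite (curl i a b) mulrC mulrA.
Qed.

Section piola.
Context {R : realType} {n : nat}.
Implicit Types (x : 'rV[R]_n) (f : 'rV[R]_n -> R).
Notation e i := (basis_vec i : 'rV[R]_n).

(** The adjugate of the Jacobian matrix of a map is divergence free.  The second
    hypothesis says that [M] is such a matrix, at the level of first
    derivatives. *)
Lemma piola (M : 'rV[R]_n -> 'M[R]_n) x (j : 'I_n) :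
  (forall i k, smooth (fun y => M y i k)) ->
  (forall i a b, 'D_(e i) (fun y => M y a b) x = 'D_(e a) (fun y => M y i b) x) ->
  \det (M x) != 0 ->
  \sum_i 'D_(e i) (fun y => \adj (M y) j i) x = 0.
Proof.
move=> sM curl dx; apply: (mulfI dx); rewrite mulr0.
pose dM i := \matrix_(a, b) 'D_(e i) (fun y => M y a b) x.
pose dA i := \matrix_(a, b) 'D_(e i) (fun y => \adj (M y) a b) x.
have hM i a b : is_derive x (e i) (fun y => M y a b) (dM i a b).
  by rewrite mxE; exact: smooth_is_derive.
have hA i a b : is_derive x (e i) (fun y => \adj (M y) a b) (dA i a b).
  by rewrite mxE; apply: smooth_is_derive; exact: smooth_adj.
have := @piola_algebra _ n (M x) (\adj (M x)) (\det (M x)) dM dA j (mul_adj_mx _).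
rewrite (eq_bigr (fun i => 'D_(e i) (fun y => \adj (M y) j i) x)); last first.
  by move=> i _; rewrite mxE.
apply=> [i|i a b]; last by rewrite !mxE curl.
have hdet := jacobi_det (hM i).
apply/matrixP => a b.
have hL : is_derive x (e i) (fun y => \sum_k M y a k * \adj (M y) k b)
   (\sum_k (M x a k *: dA i k b + \adj (M x) k b *: dM i a k)).
  by apply: is_derive_bigsum => k; exact: (is_deriveM (hM i a k) (hA i k b)).
have hR : is_derive x (e i) (fun y => \det (M y) *+ (a == b))
    (\tr (\adj (M x) *m dM i) *+ (a == b)).
  case: (a == b); first by rewrite mulr1n; exact: hdet.
  by rewrite mulr0n; exact: is_derive_cst.
have E : (fun y => \sum_k M y a k * \adj (M y) k b) = (fun y => \det (M y) *+ (a == b)).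
  apply/funext => y; have /matrixP/(_ a b) := mul_mx_adj (M y).
  by rewrite !mxE.
rewrite E in hL; have := @derive_val _ _ _ _ _ _ _ hL.
rewrite (@derive_val _ _ _ _ _ _ _ hR) => {}E.
rewrite [RHS]mxE E mxE [X in X + _]mxE [X in _ + X]mxE -big_split /=.
apply: eq_bigr => k _; rewrite addrC; congr (_ + _); exact: mulrC.
Qed.

End piola.

(** * Elementary symmetric functions of a Jacobian matrix as divergences *)

Lemma horner_char_poly (F : comNzRingType) n (A : 'M[F]_n) (x : F) :
  (char_poly A).[x] = \det (x%:M - A).
Proof.
rewrite -[LHS]/(horner_eval x (\det (char_poly_mx A))) -det_map_mx.
congr (\det _); apply/matrixP => i j.
by rewrite !mxE /= /horner_eval !hornerE hornerMn hornerX.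
Qed.

Lemma det_add1_scale (F : fieldType) n (A : 'M[F]_n) (l : n.-tuple F) (t : F) :
  char_poly A = \prod_(a <- l) ('X - a%:P) ->
  \det (1%:M + t *: A) = \prod_(i < n) (1 + t * tnth l i).
Proof.
move=> hA; have [->|t0] := eqVneq t 0.
  rewrite scale0r addr0 det1 big1 // => i _.
  by rewrite mul0r addr0.
have -> : 1%:M + t *: A = (- t) *: ((- t^-1)%:M - A).
  apply/matrixP => i j; rewrite !mxE.
  by case: (i == j); rewrite ?mulr1n ?mulr0n; field.
rewrite detZ -horner_char_poly hA big_tuple horner_prod -[X in _ ^+ X]card_ord.
rewrite -prodr_const -big_split /=; apply: eq_bigr => i _.
by rewrite !hornerE; field.
Qed.

Section esym.
Context {R : realType} {n : nat}.

Lemma prod_add1_esym (l : n.-tuple R) (t : R) :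
  \prod_(i < n) (1 + t * tnth l i) = \sum_(k < n.+1) Defs.esym k l * t ^+ k.
Proof.
under eq_bigr do rewrite addrC.
rewrite bigA_distr (partition_big (fun I : {set 'I_n} => inord #|I| : 'I_n.+1) predT) //=.
apply: eq_bigr => k _; rewrite mulr_suml; apply: eq_big => [I|I].
  rewrite -(inj_eq val_inj) /= inordK // ltnS.
  by rewrite -[X in (_ <= X)%N]card_ord max_card.
move=> /eqP <-; rewrite inordK; last first.
  by rewrite ltnS -[X in (_ <= X)%N]card_ord max_card.
by rewrite -prodr_const -big_split /= [RHS]big_mkcond; apply: eq_bigr => i _; rewrite mulrC.
Qed.

Lemma is_derive_prod_add1_esym (l : n.-tuple R) (t : R) :
  is_derive t 1 (fun s => \prod_(i < n) (1 + s * tnth l i))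
    (\sum_(k < n) k.+1%:R * Defs.esym k.+1 l * t ^+ k).
Proof.
rewrite (_ : (fun s => _) = fun s => \sum_(k < n.+1) Defs.esym k l * s ^+ k); last first.
  by apply/funext => s; exact: prod_add1_esym.
have h : is_derive t 1 (fun s => \sum_(k < n.+1) Defs.esym k l * s ^+ k)
   (\sum_(k < n.+1) Defs.esym k l * (k%:R * t ^+ k.-1)).
  apply: is_derive_bigsum => k; apply: is_deriveZ.
  by apply: DeriveDef; [exact: exprn_derivable|rewrite exp_derive /GRing.scale /= mulr1].
apply: is_derive_eq h _; rewrite big_ord_recl /= mul0r mulr0 add0r.
by apply: eq_bigr => k _; rewrite mulrCA mulrA.
Qed.

Lemma trace_adj_esym (A : 'M[R]_n) (l : n.-tuple R) (t : R) :
  is_spectrum A l ->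
  \tr (\adj (1%:M + t *: A) *m A) =
    \sum_(k < n) k.+1%:R * Defs.esym k.+1 l * t ^+ k.
Proof.
move=> hA.
have h1 : is_derive t 1 (fun s : R => \det (1%:M + s *: A))
    (\tr (\adj (1%:M + t *: A) *m A)).
  apply: jacobi_det => i j.
  have -> : (fun y : R => (1%:M + y *: A) i j) = cst ((1%:M : 'M[R]_n) i j) + (fun y => y *: A i j).
    by apply/funext => y; rewrite !mxE.
  rewrite -[X in is_derive _ _ _ X]add0r; apply: is_deriveD.
  apply: is_derive_eq (is_deriveM (is_derive_id t 1) (is_derive_cst (A i j) t 1)) _.
  by rewrite scaler0 add0r; exact: mulr1.
have h2 := is_derive_prod_add1_esym l t.
have E : (fun s : R => \det (1%:M + s *: A)) = fun s => \prod_(i < n) (1 + s * tnth l i).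
  by apply/funext => s; exact: det_add1_scale.
rewrite -(@derive_val _ _ _ _ _ _ _ h1) -(@derive_val _ _ _ _ _ _ _ h2).
by rewrite E.
Qed.

End esym.

(** The weights extract the coefficient of degree [k] of a polynomial of degree
    less than [n] from its values at the points [t m]. *)
Lemma interpolation_weights (F : fieldType) n (t : 'I_n -> F) (k : 'I_n) :
  injective t -> exists w : 'I_n -> F,
    forall j : 'I_n, \sum_m w m * t m ^+ j = (j == k)%:R.
Proof.
move=> tI; pose T := Vandermonde n (\row_m t m).
have Tu : T \in unitmx.
  rewrite unitmxE unitfE det_Vandermonde; apply/prodf_neq0 => i _.
  apply/prodf_neq0 => j ij; rewrite !mxE subr_eq0 (inj_eq tI).
  by apply: contraTneq ij => ->; rewrite ltnn.
exists (fun m => invmx T m k) => j.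
have /matrixP/(_ j k) := mulmxV Tu; rewrite !mxE => <-.
by apply: eq_bigr => m _; rewrite !mxE mulrC.
Qed.

Section bounds.
Context {R : realType} {n : nat}.

Lemma det_bound m (A : 'M[R]_m) (B : R) : (forall i j, `|A i j| <= B) ->
  `|\det A| <= m`!%:R * B ^+ m.
Proof.
move=> hA; apply: le_trans (ler_norm_sum _ _ _) _.
rewrite -{1}(card_Sn m).
apply: (@le_trans _ _ (\sum_(s : 'S_m) B ^+ m)).
  apply: ler_sum => s _; rewrite normrM normr_sign mul1r normr_prod.
  rewrite -[X in _ ^+ X]card_ord -prodr_const.
  by apply: ler_prod => i _; rewrite normr_ge0 hA.
by rewrite sumr_const mulr_natl.
Qed.

(** A vector [v] with [v *m (1 + t A) = 0] satisfies [|v j| <= |t| n b |v j|] at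
    the index [j] of its largest entry. *)
Lemma det_add1_scale_neq0 (A : 'M[R]_n) (b t : R) :
  (forall i j, `|A i j| <= b) -> `|t| * (n%:R * b) < 1 ->
  \det (1%:M + t *: A) != 0.
Proof.
move=> hA tb; apply/negP => /det0P[v v0 vM].
have [j0 vj0] : exists j, v 0 j != 0.
  by apply/rV0Pn.
case: (arg_maxP (fun j => `|v 0 j|) (isT : predT j0)) => j _ jmax.
have vj : 0 < `|v 0 j|.
  by apply: lt_le_trans (jmax j0 isT); rewrite normr_gt0.
have /rowP/(_ j) := vM; rewrite mulmxDr mulmx1 -scalemxAr !mxE => /eqP.
rewrite addr_eq0 => /eqP /(congr1 Num.norm); rewrite normrN normrM => E.
have : `|v 0 j| <= `|t| * (n%:R * b) * `|v 0 j|.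
  rewrite {1}E -mulrA ler_wpM2l //; apply: le_trans (ler_norm_sum _ _ _) _.
  apply: (@le_trans _ _ (\sum_(i < n) b * `|v 0 j|)).
    apply: ler_sum => i _; rewrite normrM mulrC ler_pM //.
    exact: jmax.
  by rewrite sumr_const card_ord -mulrA mulr_natl.
rewrite -[leLHS]mul1r ler_pM2r // => h.
by have := le_lt_trans h tb; rewrite ltxx.
Qed.

End bounds.

Section divergence.
Context {R : realType} {n : nat}.
Implicit Types (x : 'rV[R]_n).
Notation e i := (basis_vec i : 'rV[R]_n).

Definition divergence (X : 'I_n -> 'rV[R]_n -> R) x : R := \sum_i 'D_(e i) (X i) x.

Variable (G : 'I_n -> 'rV[R]_n -> R) (g : 'I_n -> R).
Hypothesis sG : forall j, smooth (G j).

Definition jac x : 'M[R]_n := \matrix_(i, j) 'D_(e i) (G j) x.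

Let M (t : R) x := 1%:M + t *: jac x.

Let smooth_M t i j : smooth (fun x => M t x i j).
Proof.
apply: (smooth_ext (f := fun x => (1%:M : 'M[R]_n) i j + t * 'D_(e i) (G j) x)).
  by move=> x; rewrite !mxE.
apply: smoothD; first exact: smooth_cst.
by apply: smoothM; [exact: smooth_cst|exact: smooth_derive].
Qed.

(** The field [(G - g) adj (I + t DG)], a row vector. *)
Definition adj_field (t : R) (i : 'I_n) x : R :=
  \sum_j (G j x - g j) * \adj (1%:M + t *: jac x) j i.

Lemma smooth_adj_field t i : smooth (adj_field t i).
Proof.
apply: smooth_sum => j _; apply: smoothM; last exact: smooth_adj (smooth_M t).
by apply: smoothD => //; exact: smooth_cst.
Qed.

(** Half of the product rule vanishes by Piola's identity, which applies because
    second derivatives commute. *)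
Lemma div_adj_field t x : \det (1%:M + t *: jac x) != 0 ->
  divergence (adj_field t) x = \tr (\adj (1%:M + t *: jac x) *m jac x).
Proof.
move=> d0.
have sA j i : smooth (fun x => \adj (M t x) j i) by exact: smooth_adj (smooth_M t).
have hX i : 'D_(e i) (adj_field t i) x =
   \sum_j ((G j x - g j) * 'D_(e i) (fun y => \adj (M t y) j i) x +
           \adj (M t x) j i * 'D_(e i) (G j) x).
  apply: derive_val; apply: is_derive_bigsum => j.
  have h : is_derive x (e i) (fun y => G j y - g j) ('D_(e i) (G j) x).
    rewrite -[X in is_derive _ _ _ X]subr0; apply: is_deriveB.
    exact: smooth_is_derive.
  exact: (is_deriveM h (smooth_is_derive _ _ (sA j i))).
rewrite /divergence; under eq_bigr do rewrite hX big_split /=.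
rewrite big_split /= [X in X + _](_ : _ = 0) ?add0r.
  rewrite exchange_big; apply: eq_bigr => j _.
  by rewrite mxE; apply: eq_bigr => i _; rewrite [jac x i j]mxE.
rewrite exchange_big big1 // => j _; rewrite -mulr_sumr piola ?mulr0 //.
move=> i a b.
have DM c d k : 'D_(e k) (fun y => M t y c d) x = t * 'D_(e k) (fun y => 'D_(e c) (G d) y) x.
  apply: derive_val.
  have -> : (fun y => M t y c d) = cst ((1%:M : 'M[R]_n) c d) + (t \*: (fun y => 'D_(e c) (G d) y)).
    by apply/funext => y; rewrite !mxE.
  rewrite -[X in is_derive _ _ _ X]add0r; apply: is_deriveD.
  by apply: is_deriveZ; apply: smooth_is_derive; exact: smooth_derive.
by rewrite !DM schwarz.
Qed.

Lemma adj_field_bound (t b : R) x i :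
  (forall i j, `|jac x i j| <= b) -> `|t| <= 1 ->
  `|adj_field t i x| <= n.-1`!%:R * (1 + b) ^+ n.-1 * \sum_j `|G j x - g j|.
Proof.
move=> hb t1; apply: le_trans (ler_norm_sum _ _ _) _; rewrite mulr_sumr.
apply: ler_sum => j _; rewrite normrM mulrC ler_wpM2r //.
rewrite mxE /cofactor normrM normrX normrN1 expr1n mul1r.
apply: det_bound => k l; rewrite !mxE; apply: le_trans (ler_normD _ _) _.
apply: lerD; first by case: (_ == _); rewrite ?normr1 ?normr0.
rewrite normrM -[leRHS]mul1r ler_pM //; have := hb (lift i k) (lift j l).
by rewrite mxE.
Qed.

Lemma divergence_sum w (t : 'I_n -> R) x :
  divergence (fun i y => \sum_m w m * adj_field (t m) i y) x =
  \sum_m w m * divergence (adj_field (t m)) x.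
Proof.
rewrite /divergence; under [RHS]eq_bigr do rewrite mulr_sumr.
rewrite [RHS]exchange_big; apply: eq_bigr => i _; apply: derive_val.
apply: is_derive_bigsum => m; apply: is_deriveZ.
by apply: smooth_is_derive; exact: smooth_adj_field.
Qed.

(** The divergence of [adj_field t] is the derivative in [t] of
    [sum_k t^k S_k], a polynomial in [t] of degree less than [n]: its coefficient
    of degree [k] is a combination of the divergences for [n] values of [t].
    The boundedness of the Jacobian matrix serves twice: to choose these values
    so small that [I + t DG] is invertible everywhere, as Piola's identity
    requires here, and to bound the adjugate. *)
Lemma esym_divergence (b : R) (l : 'rV[R]_n -> n.-tuple R) (k : 'I_n) :
  (forall x i j, `|jac x i j| <= b) -> (forall x, is_spectrum (jac x) (l x)) ->
  exists (X : 'I_n -> 'rV[R]_n -> R) (C : R),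
    [/\ forall i, smooth (X i),
        forall x i, `|X i x| <= C * \sum_j `|G j x - g j| &
        forall x, divergence X x = k.+1%:R * Defs.esym k.+1 (l x)].
Proof.
move=> hb hl.
have b0 : 0 <= b by apply: le_trans (hb 0 k k).
pose tau : R := (n.+1%:R ^+ 2 * (b + 1))^-1.
have D0 : 0 < n.+1%:R ^+ 2 * (b + 1).
  by rewrite mulr_gt0 ?exprn_gt0 ?ltr0n // ltr_wpDl.
have tau0 : 0 < tau by rewrite invr_gt0.
pose t (m : 'I_n) : R := m.+1%:R * tau.
have t_ge0 m : 0 <= t m by rewrite mulr_ge0 // ltW.
have tle m : t m <= n%:R * tau by rewrite ler_wpM2r ?ler_nat // ltW.
have tI : injective t.
  move=> m m' /(mulIf (lt0r_neq0 tau0)) /eqP; rewrite eqr_nat => /eqP[].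
  exact: val_inj.
(* The points [t m] are at most [n tau], where [n tau <= 1] and
   [n tau (n b) < 1]. *)
have n1 : (1 : R) <= n.+1%:R by rewrite ler1n.
have nn1 : n%:R <= (n.+1%:R : R) by rewrite ler_nat.
have n0 : (0 : R) <= n%:R by [].
have t1 m : `|t m| <= 1.
  rewrite ger0_norm // (le_trans (tle m)) // ler_pdivrMr // mul1r expr2 -mulrA.
  rewrite -[leLHS]mulr1 ler_pM // -[leLHS]mul1r ler_pM // lerDr //.
have td x m : \det (1%:M + t m *: jac x) != 0.
  apply: det_add1_scale_neq0 (hb x) _; rewrite ger0_norm //.
  apply: (@le_lt_trans _ _ (n%:R * tau * (n%:R * b))).
    by rewrite ler_wpM2r // mulr_ge0.
  rewrite mulrAC ltr_pdivrMr // mul1r mulrA -expr2.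
  apply: (@le_lt_trans _ _ (n.+1%:R ^+ 2 * b)).
    by rewrite ler_wpM2r // lerXn2r // nnegrE.
  by rewrite ltr_pM2l ?ltrDl // exprn_gt0.
have [w hw] := interpolation_weights k tI.
exists (fun i y => \sum_m w m * adj_field (t m) i y).
exists (\sum_m `|w m| * (n.-1`!%:R * (1 + b) ^+ n.-1)); split.
- move=> i; apply: smooth_sum => m _; apply: smoothM; first exact: smooth_cst.
  exact: smooth_adj_field.
- move=> x i; apply: le_trans (ler_norm_sum _ _ _) _; rewrite mulr_suml.
  apply: ler_sum => m _; rewrite normrM -mulrA ler_wpM2l //.
  exact: adj_field_bound.
- move=> x; rewrite divergence_sum.
  under eq_bigr do rewrite div_adj_field // (trace_adj_esym _ (hl x)) mulr_sumr.
  rewrite exchange_big /= (bigD1 k) //= [X in _ + X]big1 ?addr0.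
    under eq_bigr do rewrite mulrCA.
    by rewrite -mulr_sumr hw eqxx mulr1.
  move=> j /negbTE jk; under eq_bigr do rewrite mulrCA.
  by rewrite -mulr_sumr hw jk mulr0.
Qed.

End divergence.

(** * Lebesgue integration on tuples *)

Section measurability.
Context {R : realType} {n : nat}.
Notation mR := (measurableTypeR R).

(** Balls with rational centre and radius [1 / (k + 1)] form a countable basis:
    an open subset of ['rV_n] is a countable union of boxes, which is what
    relates its topology to the product sigma-algebra on tuples. *)
Lemma rational_ball (U : set 'rV[R]_n) (x : 'rV[R]_n) : open U -> U x ->
  exists q : 'rV[rat]_n * nat,
    ball (map_mx ratr q.1 : 'rV[R]_n) q.2.+1%:R^-1 x /\
    ball (map_mx ratr q.1 : 'rV[R]_n) q.2.+1%:R^-1 `<=` U.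
Proof.
move=> oU Ux; have /nbhs_ballP[e /= e0 eU] := open_nbhs_nbhs (conj oU Ux).
have [k ke] : exists k : nat, k.+1%:R^-1 < e / 2 :> R.
  have e2 : 0 < e / 2 by rewrite divr_gt0.
  have [k _ /(_ k (leqnn k))/=] := near_infty_natSinv_lt (PosNum e2).
  by exists k.
have k0 : 0 < k.+1%:R^-1 :> R by rewrite invr_gt0 ltr0n.
have hx (i : 'I_n) : exists q : rat, `|ratr q - x ord0 i| < k.+1%:R^-1.
  have /rat_in_itvoo[q] : x ord0 i - k.+1%:R^-1 < x ord0 i + k.+1%:R^-1.
    by rewrite ltrD2l gtrN.
  rewrite in_itv /= => /andP[h1 h2]; exists q.
  by move: h1 h2; move: (_^-1) => d h1 h2; rewrite ltr_norml; apply/andP; split; lra.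
have [q hq] := fin_all_exists hx.
exists (\row_i q i, k); split; first by split=> // i j; rewrite !mxE ord1 /ball /=.
apply: subset_trans eU => y [_ hy]; split=> // i j; rewrite ord1 {i}.
have := hy ord0 j; rewrite !mxE /ball /= => h1; have h2 := hq j.
rewrite (splitr e); apply: le_lt_trans (ler_distD (ratr (q j)) _ _) _.
by rewrite distrC; apply: ltrD; [exact: lt_trans h2 ke|exact: lt_trans h1 ke].
Qed.

Lemma measurable_rowt (U : set 'rV[R]_n) : open U ->
  measurable [set t : n.-tuple mR | U (rowt t)].
Proof.
move=> oU.
pose B (q : 'rV[rat]_n * nat) := ball (map_mx ratr q.1 : 'rV[R]_n) q.2.+1%:R^-1.
pose F (q : 'rV[rat]_n * nat) : set (n.-tuple mR) :=
  [set t | B q `<=` U /\ B q (rowt t)].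
have -> : [set t : n.-tuple mR | U (rowt t)] = \bigcup_q F q.
  apply/seteqP; split=> [t /= Ut|t [q _ [qU qt]]]; last exact: qU.
  by have [q [qt qU]] := rational_ball oU Ut; exists q.
apply: countable_bigcupT_measurable => [|q]; first exact: countableP.
have [qU|nqU] := pselect (B q `<=` U); last first.
  rewrite (_ : F q = set0); first exact: measurable0.
  by apply/seteqP; split => // t [].
have -> : F q = \bigcap_(i in [set: 'I_n])
    (fun t => tnth t i) @^-1` (ball (ratr (q.1 ord0 i) : R) q.2.+1%:R^-1).
  apply/seteqP; split=> [t [_ [_ h]] i _ /=|t h].
    by have := h ord0 i; rewrite !mxE.
  split=> //; split; first by rewrite invr_gt0 ltr0n.
  by move=> i j; rewrite !mxE ord1; exact: h.
apply: fin_bigcap_measurable; first exact: finite_finset.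
move=> i _; rewrite -[X in measurable X]setTI; apply: measurable_tnth => //.
exact: measurable_ball.
Qed.

Lemma measurable_continuous_rowt (f : 'rV[R]_n -> R) : continuous f ->
  measurable_fun setT (fun t : n.-tuple mR => f (rowt t)).
Proof.
move=> /continuousP cf.
apply: (measurability _ (RGenOpens.measurableE R)) => //.
move=> _ [_ [x [y ->]] <-]; rewrite setTI.
have o : open `]x, y[%classic by exact: interval_open.
exact: (measurable_rowt (cf _ o)).
Qed.

End measurability.

Section tuple_measure.
Context {R : realType}.
Notation mR := (measurableTypeR R).
Notation leb := (@lebesgue_measure R).
Notation lebn n := (@lebesgue_tuple R n).

Definition tuple_upd n (t : n.-tuple mR) (i : 'I_n) (s : R) : n.-tuple mR :=
  [tuple (if j == i then s else tnth t j) | j < n].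

Lemma tuple_upd_cons0 n (x s : R) (t : n.-tuple mR) :
  tuple_upd (cons_pair (x, t)) ord0 s = cons_pair (s, t).
Proof.
apply: eq_from_tnth => j; rewrite tnth_mktuple.
case: (unliftP ord0 j) => [k ->|->]; last by rewrite eqxx [RHS]tnth0.
by rewrite eq_sym (negbTE (neq_lift _ _)) [LHS]tnthS [RHS]tnthS.
Qed.

Lemma tuple_upd_consS n (x s : R) (t : n.-tuple mR) (i : 'I_n) :
  tuple_upd (cons_pair (x, t)) (lift ord0 i) s = cons_pair (x, tuple_upd t i s).
Proof.
apply: eq_from_tnth => j; rewrite tnth_mktuple.
case: (unliftP ord0 j) => [k ->|->].
  rewrite [RHS]tnthS tnth_mktuple (inj_eq lift_inj); case: ifP => // _.
  by rewrite [LHS]tnthS.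
by rewrite (negbTE (neq_lift _ _)) [LHS]tnth0 [RHS]tnth0.
Qed.

(** Fubini's theorem in the form needed for the divergence theorem: a function
    whose integrals along all lines parallel to one axis vanish has integral
    zero.  The measure on tuples peels off the first coordinate: if [i] is that
    coordinate, it is integrated first, and otherwise last, by induction. *)
Lemma integral_slice n (g : n.-tuple mR -> \bar R) (i : 'I_n) :
  (lebn n).-integrable setT g ->
  (forall t, \int[leb]_(s in setT) g (tuple_upd t i s) = 0)%E ->
  (\int[lebn n]_(t in setT) g t = 0)%E.
Proof.
elim: n g i => [g []//|n IH g i ig g0].
have mg : measurable_fun setT g by exact: measurable_int ig.
have mcp := @measurable_cons_pair R n.
have ig' : (leb \x lebn n)%E.-integrable setT (g \o @cons_pair R n).
  have [_ goo] := integrableP _ _ _ ig.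
  apply/integrableP; split; first exact: measurableT_comp.
  apply: le_lt_trans goo; rewrite [leRHS](ge0_integral_pushforward mcp) //.
  exact: measurableT_comp.
have -> : (\int[lebn n.+1]_(t in setT) g t =
           \int[(leb \x lebn n)%E]_(p in setT) g (cons_pair p))%E.
  exact: (integral_pushforward mcp mg).
case: (unliftP ord0 i) g0 => [k ->|->] g0.
  rewrite -(integral12_prod_meas1 ig') /fubini_F.
  have ae := ae_integrable1 ig'.
  rewrite (ae_eq_integral (cst 0%E)) //; first exact: integral0.
    exact: measurable_fubini_F ig'.
  apply: filterS ae => x ix _; apply: (IH _ k) => //= t.
  by rewrite -[RHS](g0 (cons_pair (x, t))); under [RHS]eq_integral do rewrite tuple_upd_consS.
rewrite -(integral21_prod_meas1 ig') /fubini_G.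
apply: integral0_eq => t _ /=.
by rewrite -[RHS](g0 (cons_pair (0, t))); under [RHS]eq_integral do rewrite tuple_upd_cons0.
Qed.

Definition tbox n (A : 'I_n -> set mR) : set (n.-tuple mR) :=
  [set t | forall i, A i (tnth t i)].

Lemma measurable_tbox n (A : 'I_n -> set mR) :
  (forall i, measurable (A i)) -> measurable (tbox A).
Proof.
move=> mA; have -> : tbox A = \bigcap_(i in [set: 'I_n]) (fun t => tnth t i) @^-1` A i.
  by apply/seteqP; split=> [t h i _|t h i]; exact: h.
apply: fin_bigcap_measurable; first exact: finite_finset.
by move=> i _; rewrite -[X in measurable X]setTI; apply: measurable_tnth.
Qed.

Lemma lebesgue_tbox n (A : 'I_n.+1 -> set mR) : (forall i, measurable (A i)) ->
  lebn n.+1 (tbox A) = (leb (A ord0) * lebn n (tbox (fun i => A (lift ord0 i))))%E.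
Proof.
move=> mA; rewrite -product_measure1E //; last by apply: measurable_tbox => i.
have -> : lebn n.+1 (tbox A) = (leb \x lebn n)%E (@cons_pair R n @^-1` tbox A) by [].
congr (product_measure1 _ _ _).
apply/seteqP; split=> [[x t] h|[x t] [h0 h] i].
  by split=> [|i /=]; [have := h ord0; rewrite tnth0|have := h (lift ord0 i); rewrite tnthS].
by case: (unliftP ord0 i) => [k ->|->]; rewrite /cons_pair ?tnthS ?tnth0 //; exact: h.
Qed.

Lemma tbox_ltoo n (A : 'I_n -> set mR) : (forall i, measurable (A i)) ->
  (forall i, leb (A i) < +oo)%E -> (lebn n (tbox A) < +oo)%E.
Proof.
elim: n A => [|n IH] A mA fA.
  have -> : lebn 0 (tbox A) = (\d_([tuple of [::]] : 0.-tuple mR) (tbox A))%E by [].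
  by rewrite diracE; case: (_ \in _); rewrite ltry.
rewrite lebesgue_tbox //; apply: lte_mul_pinfty => //.
- by rewrite ge0_fin_numE.
- by apply: IH.
Qed.

Lemma tbox_gt0 n (A : 'I_n -> set mR) : (forall i, measurable (A i)) ->
  (forall i, 0 < leb (A i))%E -> (0 < lebn n (tbox A))%E.
Proof.
elim: n A => [|n IH] A mA fA.
  have -> : lebn 0 (tbox A) = (\d_([tuple of [::]] : 0.-tuple mR) (tbox A))%E by [].
  rewrite diracE mem_set ?lte_fin //.
  by move=> [].
by rewrite lebesgue_tbox //; apply: mule_gt0 => //; exact: IH.
Qed.

End tuple_measure.

(** * Integrable fields whose divergence has a sign *)

Section flux.
Context {R : realType} {n : nat}.
Notation mR := (measurableTypeR R).
Notation leb := (@lebesgue_measure R).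
Notation lebn := (@lebesgue_tuple R n).
Notation e i := (basis_vec i : 'rV[R]_n).
Implicit Types (F f : 'rV[R]_n -> R).

Definition cube (rho : R) : set (n.-tuple mR) := tbox (fun=> `[(- rho), rho]%classic).

Lemma measurable_cube rho : measurable (cube rho).
Proof. by apply: measurable_tbox => _; exact: measurable_itv. Qed.

Lemma integrable_cube f rho : continuous f ->
  lebn.-integrable (cube rho) (fun t => (f (rowt t))%:E).
Proof.
move=> cf; apply: (measurable_bounded_integrable (mu := lebn) (f := fun t => f (rowt t))).
- exact: measurable_cube.
- apply: tbox_ltoo => _; first exact: measurable_itv.
  by rewrite lebesgue_measure_itv /=; case: ifP => _; rewrite ?ltry // -EFinB ltry.
- by apply: measurable_funTS; exact: measurable_continuous_rowt.
have cK : compact [set v : 'rV[R]_n | forall i, `[(- rho), rho]%classic (v ord0 i)].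
  by apply: (@rV_compact _ _ (fun=> `[(- rho), rho]%classic)) => _; exact: segment_compact.
have /compact_bounded[M [Mr HM]] := continuous_compact (continuous_subspaceT cf) cK.
exists M; split=> // y My t ct; apply: (HM _ My).
exists (rowt t) => // i; rewrite mxE; exact: ct.
Qed.

Lemma rowt_tuple_upd (t : n.-tuple mR) i s :
  rowt (tuple_upd t i s) = rowt (tuple_upd t i 0) + s *: e i.
Proof.
apply/rowP => j; rewrite !mxE !tnth_mktuple eqxx /= eq_sym.
by case: eqVneq => _; rewrite /= ?mulr1 ?mulr0 ?add0r ?addr0.
Qed.

(** Along a line in the direction [i], the integrand is either zero or the
    derivative of a function vanishing at both ends of the segment cut out by
    the cube. *)
Lemma integral_derive_cube F (i : 'I_n) (rho : R) : 0 < rho -> smooth F ->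
  (forall x : 'rV[R]_n, `|x ord0 i| = rho -> F x = 0) ->
  (\int[lebn]_(t in cube rho) ('D_(e i) F (rowt t))%:E = 0)%E.
Proof.
move=> rho0 sF F0.
have sDF := smooth_derive (e i) sF.
rewrite integral_mkcond; apply: (integral_slice (i := i)).
  apply/(integrable_mkcond _ (measurable_cube rho)).
  exact: integrable_cube (smooth_cont sDF).
move=> t.
have [tin|] := pselect (forall j, j != i -> - rho <= tnth t j <= rho); last first.
  move=> /existsNP[j /not_implyP[ji tj]]; apply: integral0_eq => s _.
  rewrite patchE; case: ifPn => //; rewrite inE => /(_ j).
  by rewrite /= tnth_mktuple (negbTE ji) in_itv.
pose y := rowt (tuple_upd t i 0).
transitivity (\int[leb]_(s in `[(- rho)%R, rho]) ('D_(e i) F ((y + s *: e i)%R))%:E)%E.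
  rewrite [RHS]integral_mkcond; apply: eq_integral => s _.
  rewrite !patchE rowt_tuple_upd -/y.
  suff -> : (tuple_upd t i s \in cube rho) = (s \in `[(- rho), rho]%classic) by [].
  apply/idP/idP; rewrite !inE.
    by move=> /(_ i); rewrite tnth_mktuple eqxx.
  move=> sr j; rewrite tnth_mktuple; case: eqVneq => // ji.
  by rewrite /= in_itv; exact: tin.
have cF := @cont_line _ _ F y (e i) (smooth_cont sF).
rewrite (@continuous_FTC2 _ _ (fun s => F (y + s *: e i))).
- rewrite !F0 ?subee // !mxE tnth_mktuple !eqxx /= mulr1 add0r.
    by rewrite normrN gtr0_norm.
  by rewrite gtr0_norm.
- lra.
- exact: (continuous_subspaceT (@cont_line _ _ _ y (e i) (smooth_cont sDF))).
- split.
  + move=> s _; have h := is_derive_line (smooth_diff (y + s *: e i) sF).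
    by case: h.
  + apply: cvg_at_right_filter; exact: cF.
  + apply: cvg_at_left_filter; exact: cF.
- move=> s _; rewrite derive1E; apply: derive_val.
  by apply: is_derive_line; exact: smooth_diff.
Qed.

(** The cutoff function.  It vanishes on the boundary of the cube of half-side
    [rho], so it is only used there; being a polynomial, it is smooth without
    any gluing. *)
Definition bump rho (x : 'rV[R]_n) : R := \prod_j (1 - (x ord0 j / rho) ^+ 2).

Lemma is_derive_coord (x v : 'rV[R]_n) j :
  is_derive x v (fun y : 'rV[R]_n => y ord0 j) (v ord0 j).
Proof.
have cl : continuous (fun y : 'rV[R]_n => y ord0 j) by exact: coord_continuous.
have ll : linear (fun y : 'rV[R]_n => y ord0 j : R) by move=> a u w; rewrite !mxE.
pose lM := GRing.isLinear.Build _ _ _ _ _ ll.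
pose L : {linear 'rV[R]_n -> R} := HB.pack (fun y : 'rV[R]_n => y ord0 j : R) lM.
apply: DeriveDef; first exact/diff_derivable/differentiable_coord.
by rewrite deriveE; [rewrite (diff_lin x (f := L) cl)|exact: differentiable_coord].
Qed.

Lemma smooth_coord j : smooth (fun x : 'rV[R]_n => x ord0 j).
Proof.
case=> [|k]; first by move=> x _; exact: coord_continuous.
apply/CkS; split=> [x|v]; first exact: differentiable_coord.
apply: (Ck_ext (f := fun=> v ord0 j)); last exact: Ck_cst.
by move=> x; apply/esym/derive_val; exact: is_derive_coord.
Qed.

Lemma smooth_bump rho : smooth (bump rho).
Proof.
apply: smooth_prod => j _; apply: smoothD; first exact: smooth_cst.
apply: smoothN.
have s1 : smooth (fun x : 'rV[R]_n => x ord0 j / rho).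
  by apply: smoothM; [exact: smooth_coord|exact: smooth_cst].
exact: (smoothM s1 s1).
Qed.

Definition in_cube (rho : R) (x : 'rV[R]_n) := forall j, `|x ord0 j| <= rho.

Lemma bump_factor rho (x : 'rV[R]_n) j : 0 < rho -> in_cube rho x ->
  0 <= 1 - (x ord0 j / rho) ^+ 2 <= 1.
Proof.
move=> rho0 /(_ j) xj; rewrite subr_ge0 lerBlDr lerDl sqr_ge0 andbT.
by rewrite -real_normK ?num_real // -[leRHS](expr1n _ 2) lerXn2r ?nnegrE // normrM normfV
   (gtr0_norm rho0) ler_pdivrMr // mul1r.
Qed.

Lemma bump_ge0 rho x : 0 < rho -> in_cube rho x -> 0 <= bump rho x.
Proof. by move=> r0 cx; apply: prodr_ge0 => j _; case/andP: (bump_factor j r0 cx). Qed.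

Lemma bump_ge_half rho x : 0 < rho -> in_cube (rho / 2) x -> 2^-1 ^+ n <= bump rho x.
Proof.
move=> r0 cx; rewrite -[X in _ ^+ X]card_ord -prodr_const; apply: ler_prod => j _.
rewrite invr_ge0 ler0n /=.
have -> : x ord0 j / rho = (x ord0 j / (rho / 2)) / 2 by field; rewrite gt_eqF.
have r2 : 0 < rho / 2 by rewrite divr_gt0.
have /andP[] := bump_factor j r2 cx.
move: (x ord0 j / (rho / 2)) => z; rewrite expr_div_n; lra.
Qed.

Lemma bump_derive rho x i : 0 < rho -> in_cube rho x ->
  `|'D_(e i) (bump rho) x| <= n%:R * (2 / rho).
Proof.
move=> r0 cx.
have r0' : rho != 0 by rewrite gt_eqF.
pose d j : R := - (2 * (x ord0 j / rho) * ((e i) ord0 j / rho)).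
have hf j : is_derive x (e i) (fun y : 'rV[R]_n => 1 - (y ord0 j / rho) ^+ 2) (d j).
  have h1 : is_derive x (e i) (fun y : 'rV[R]_n => y ord0 j / rho) ((e i) ord0 j / rho).
    have h := is_deriveM (is_derive_coord x (e i) j) (is_derive_cst (rho^-1) x (e i)).
    by apply: is_derive_eq h _; rewrite scaler0 add0r; exact: mulrC.
  have h2 := is_deriveB (is_derive_cst (1 : R) x (e i)) (is_deriveX 2 h1).
  by apply: is_derive_eq h2 _; rewrite /d expr1 sub0r.
rewrite (@derive_val _ _ _ _ _ _ _ (is_derive_prod hf)).
apply: le_trans (ler_norm_sum _ _ _) _.
rewrite [leRHS]mulr_natl -[X in _ <= _ *+ X]card_ord -sumr_const; apply: ler_sum => k _.
rewrite normr_prod (bigD1 k) //= eqxx -[leRHS]mulr1; apply: ler_pM => //.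
- by apply: prodr_ge0.
- rewrite /d normrN !normrM normfV (gtr0_norm r0) (gtr0_norm (ltr0Sn _ 1)).
  have hx : `|x ord0 k| / rho <= 1 by rewrite ler_pdivrMr // mul1r.
  have he : `|(e i) ord0 k| <= 1.
    by rewrite mxE; case: (_ && _); rewrite ?normr1 ?normr0.
  have x0 : 0 <= `|x ord0 k| / rho by rewrite divr_ge0 // ltW.
  apply: ler_pM; rewrite ?mulr_ge0 ?invr_ge0 ?(ltW r0) //.
    by rewrite -[leRHS]mulr1 ler_wpM2l.
  by rewrite -[leRHS]mul1r ler_wpM2r // invr_ge0 ltW.
apply: prodr_ile1 => j /negbTE jk; rewrite jk normr_ge0 /=.
by have /andP[a0 a1] := bump_factor j r0 cx; rewrite ger0_norm.
Qed.

(** The divergence of [bump rho] times [X] has integral zero over the cube, and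
    the gradient of [bump rho] is of order [1 / rho] there. *)
Lemma divergence_bump_le (X : 'I_n -> 'rV[R]_n -> R) (h : 'rV[R]_n -> R) (C rho : R) :
  (forall i, smooth (X i)) -> L1_Rn h -> (forall x, 0 <= h x) -> 0 <= C ->
  (forall x i, `|X i x| <= C * h x) -> 0 < rho ->
  (\int[lebn]_(t in cube rho) (bump rho (rowt t) * divergence X (rowt t))%:E <=
    (n%:R * (C * (n%:R * (2 / rho))))%:E * \int[lebn]_t (h (rowt t))%:E)%E.
Proof.
move=> sX hL1 h0 C0 hX rho0.
have sbX i : smooth (fun x => bump rho x * X i x).
  by apply: smoothM => //; exact: smooth_bump.
have sbd : smooth (fun x => bump rho x * divergence X x).
  apply: smoothM; first exact: smooth_bump.
  by apply: smooth_sum => i _; exact: smooth_derive.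
have DbX i x : 'D_(e i) (fun x => bump rho x * X i x) x =
   bump rho x * 'D_(e i) (X i) x + X i x * 'D_(e i) (bump rho) x.
  apply: derive_val.
  exact: (is_deriveM (smooth_is_derive _ _ (smooth_bump rho)) (smooth_is_derive _ _ (sX i))).
pose k := n%:R * (C * (n%:R * (2 / rho))).
have k0 : 0 <= k by rewrite !mulr_ge0 ?ler0n ?invr_ge0 ?(ltW rho0).
pose S (x : 'rV[R]_n) : R := \sum_i 'D_(e i) (fun x => bump rho x * X i x) x.
have mc := measurable_cube rho.
have iS : lebn.-integrable (cube rho) (fun t => (S (rowt t))%:E).
  apply/integrable_cube/smooth_cont/smooth_sum => i _; exact: smooth_derive.
have ih : lebn.-integrable (cube rho) (fun t => (h (rowt t))%:E).
  exact: (integrableS measurableT mc (@subsetT _ _) hL1).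
have ikh : lebn.-integrable (cube rho) (fun t => k%:E * (h (rowt t))%:E)%E.
  exact: integrableZl.
apply: (@le_trans _ _ (\int[lebn]_(t in cube rho) ((S (rowt t))%:E + k%:E * (h (rowt t))%:E))%E).
  apply: le_integral => //.
  - exact: (integrable_cube rho (smooth_cont sbd)).
  - exact: integrableD.
  move=> t; rewrite inE => ct; rewrite -EFinM -EFinD lee_fin.
  set x := rowt t.
  have cx : in_cube rho x.
    by move=> j; rewrite ler_norml mxE; have := ct j; rewrite /= in_itv.
  rewrite -lerBlDl /S -sumrN /divergence mulr_sumr -big_split /=.
  have -> : k * h x = \sum_(i < n) C * (n%:R * (2 / rho)) * h x.
    by rewrite sumr_const card_ord /k -mulrA mulr_natl.
  apply: ler_sum => i _; rewrite DbX opprD addNKr.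
  apply: le_trans (ler_norm _) _; rewrite normrN normrM mulrAC.
  by apply: ler_pM => //; exact: bump_derive.
have S0 : (\int[lebn]_(t in cube rho) (S (rowt t))%:E = 0)%E.
  under eq_integral do rewrite /S -sumEFin.
  rewrite integral_sum //; last first.
    move=> i; exact: (integrable_cube rho (smooth_cont (smooth_derive (e i) (sbX i)))).
  apply: big1 => i _; apply: integral_derive_cube => // x xi.
  rewrite /bump (bigD1 i) //= -[X in 1 - X]real_normK ?num_real // normrM xi.
  by rewrite normfV gtr0_norm // mulfV ?gt_eqF // expr1n subrr !mul0r.
rewrite integralD // S0 add0e integralZl //.
apply: lee_wpmul2l; first by rewrite lee_fin.
apply: ge0_subset_integral => //.
- exact: measurable_int hL1.
- by move=> t _; rewrite lee_fin.
Qed.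

(** If the divergence were positive at [x0], it would be at least [eps] on a
    small box [Q] around [x0], and for large [rho], since
    [bump rho >= 2^-n] on [Q], the integral of [divergence_bump_le] would
    be bounded below independently of [rho], while its upper bound tends to
    zero. *)
Lemma divergence_eq0 (X : 'I_n -> 'rV[R]_n -> R) (h : 'rV[R]_n -> R) (C : R) :
  (forall i, smooth (X i)) -> L1_Rn h -> (forall x, 0 <= h x) ->
  (forall x i, `|X i x| <= C * h x) ->
  (forall x, 0 <= divergence X x) -> forall x, divergence X x = 0.
Proof.
move=> sX hL1 h0 hX dX x0.
have {}hX x i : `|X i x| <= `|C| * h x.
  by apply: le_trans (hX x i) _; rewrite ler_wpM2r // ler_norm.
apply/eqP; rewrite eq_le dX andbT leNgt; apply/negP => dpos.
have sdiv : smooth (divergence X).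
  by apply: smooth_sum => i _; exact: smooth_derive.
pose eps := divergence X x0 / 2.
have eps0 : 0 < eps by rewrite divr_gt0.
have [delta delta0 hd] : exists2 d, 0 < d & forall x : 'rV[R]_n,
    (forall j, `|x0 ord0 j - x ord0 j| < d) -> eps <= divergence X x.
  have cx0 : divergence X x @[x --> x0] --> divergence X x0 by exact: smooth_cont.
  have /cvgrPdist_lt/(_ _ eps0)/nbhs_ballP[d /= d0 H] := cx0.
  exists d => // x xd; have := H x; rewrite /= => H'.
  have {}H' : `|divergence X x0 - divergence X x| < eps.
    by apply: H'; split=> // i j; rewrite ord1; exact: xd.
  have := ltW (le_lt_trans (ler_norm _) H'); rewrite /eps; lra.
pose Q : set (n.-tuple mR) := tbox (fun j => `](x0 ord0 j - delta), (x0 ord0 j + delta)[%classic).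
have mQ : measurable Q by apply: measurable_tbox => j; exact: measurable_itv.
have lQ j : leb `](x0 ord0 j - delta), (x0 ord0 j + delta)[%classic = (2 * delta)%:E.
  rewrite lebesgue_measure_itv /= lte_fin ifT -?EFinB; last by lra.
  by congr (_%:E); ring.
have Qpos : (0 < lebn Q)%E.
  apply: tbox_gt0 => j; first exact: measurable_itv.
  by rewrite lQ lte_fin mulr_gt0.
have Qfin : (lebn Q < +oo)%E.
  by apply: tbox_ltoo => j; [exact: measurable_itv|rewrite lQ ltry].
pose q := fine (lebn Q).
have qE : lebn Q = q%:E by rewrite fineK // ge0_fin_numE.
have q0 : 0 < q by rewrite -lte_fin -qE.
pose I := fine (\int[lebn]_t (h (rowt t))%:E)%E.
have IE : (\int[lebn]_t (h (rowt t))%:E = I%:E)%E.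
  by rewrite fineK //; exact: (integrable_fin_num measurableT hL1).
have I0 : 0 <= I by rewrite -lee_fin -IE; apply: integral_ge0 => t _; rewrite lee_fin.
pose M := \sum_j `|x0 ord0 j| + delta.
have M0 : 0 < M by rewrite ltr_wpDl ?sumr_ge0.
have key rho : 2 * M <= rho ->
    2^-1 ^+ n * eps * q <= n%:R * (`|C| * (n%:R * (2 / rho))) * I.
  move=> Mrho; have rho0 : 0 < rho by apply: lt_le_trans Mrho; rewrite mulr_gt0.
  rewrite -lee_fin [leRHS]EFinM -IE.
  apply: le_trans (divergence_bump_le sX hL1 h0 (normr_ge0 C) hX rho0).
  have mbd (D : set (n.-tuple mR)) :
      measurable_fun D (fun t => (bump rho (rowt t) * divergence X (rowt t))%:E).
    apply/measurable_EFinP; apply: measurable_funTS.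
    exact: (measurable_continuous_rowt (smooth_cont (smoothM (smooth_bump rho) sdiv))).
  have Qc t : Q t -> in_cube (rho / 2) (rowt t).
    move=> Qt j; have := Qt j; rewrite mxE /= in_itv /= => /andP[h1 h2].
    apply: (@le_trans _ _ M); last by rewrite ler_pdivlMr // mulrC.
    have : `|tnth t j - x0 ord0 j| <= delta by rewrite ler_norml; apply/andP; split; lra.
    move=> h3; rewrite /M -(subrK (x0 ord0 j) (tnth t j)) addrC.
    apply: le_trans (ler_normD _ _) _; apply: lerD => //.
    by rewrite (bigD1 j) //= lerDl sumr_ge0.
  have QC : Q `<=` cube rho.
    move=> t Qt j; have := Qc _ Qt j; rewrite mxE /= in_itv /= ler_norml => /andP[h1 h2].
    by apply/andP; split; lra.
  apply: (@le_trans _ _ (\int[lebn]_(t in Q) (bump rho (rowt t) * divergence X (rowt t))%:E)%E).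
    rewrite EFinM -qE -integral_cst //; apply: ge0_le_integral => //.
    - by move=> t _; rewrite lee_fin mulr_ge0 ?exprn_ge0 ?invr_ge0 // ltW.
    move=> t Qt; rewrite lee_fin ler_pM ?exprn_ge0 ?invr_ge0 ?(ltW eps0) //.
      by apply: bump_ge_half => //; exact: Qc.
    apply: hd => j; have := Qt j; rewrite mxE /= in_itv /= => /andP[h1 h2].
    by rewrite ltr_norml; apply/andP; split; lra.
  apply: ge0_subset_integral => //.
  - exact: measurable_cube.
  - move=> t ct; rewrite lee_fin mulr_ge0 //; apply: bump_ge0 => // j.
    by rewrite ler_norml mxE; have := ct j; rewrite /= in_itv.
pose c := 2^-1 ^+ n * eps * q.
have c0 : 0 < c by rewrite !mulr_gt0 // exprn_gt0 // invr_gt0.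
pose K := 2 * n%:R * `|C| * n%:R * I.
have K0 : 0 <= K by rewrite !mulr_ge0.
have Kc : 0 <= K / c by rewrite divr_ge0 // ltW.
(* Any [rho >= 2 M] with [rho > K / c] contradicts [key]. *)
have [rho rhoE] : exists rho, rho = 2 * M + K / c + 1 by eexists.
have rhoM : 2 * M <= rho by rewrite rhoE -addrA lerDl addr_ge0.
have rho0 : 0 < rho by apply: lt_le_trans rhoM; rewrite mulr_gt0.
have := key rho rhoM; rewrite -/c.
have -> : n%:R * (`|C| * (n%:R * (2 / rho))) * I = K / rho.
  by rewrite /K; field; rewrite gt_eqF.
rewrite ler_pdivlMr // rhoE [c * _]mulrDr [c * (_ + _)]mulrDr mulr1.
have -> : c * (K / c) = K by rewrite mulrCA mulfV ?mulr1 // gt_eqF.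
have : 0 < c * (2 * M) by rewrite !mulr_gt0.
move: (c * (2 * M)) => a; lra.
Qed.

End flux.

(** * The dependence of the unit normal on the gradient *)

Section lipschitz.
Context {R : realType} {n : nat}.
Implicit Types (p q v : 'rV[R]_n).

Lemma sqnorm_ge0 v : 0 <= sqnorm v.
Proof. by apply: sumr_ge0 => j _; exact: sqr_ge0. Qed.

Lemma coord_le_enorm v j : `|v ord0 j| <= enorm v.
Proof.
rewrite -(@ler_pXn2r _ 2) ?nnegrE ?sqrtr_ge0 // real_normK ?num_real //.
rewrite sqr_sqrtr ?sqnorm_ge0 // /sqnorm (bigD1 j) //= lerDl.
by apply: sumr_ge0 => k _; exact: sqr_ge0.
Qed.

(** The area density of a graph with gradient [v]. *)
Definition wt v : R := Num.sqrt (1 + sqnorm v).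

Lemma wt_gt0 v : 0 < wt v.
Proof. by rewrite sqrtr_gt0 ltr_pwDl // sqnorm_ge0. Qed.

Lemma wt_sqr v : wt v ^+ 2 = 1 + sqnorm v.
Proof. by rewrite sqr_sqrtr // addr_ge0 // sqnorm_ge0. Qed.

Lemma wt_ge1 v : 1 <= wt v.
Proof.
by rewrite -(@ler_pXn2r _ 2) ?nnegrE ?(ltW (wt_gt0 v)) // expr1n wt_sqr lerDl sqnorm_ge0.
Qed.

Lemma coord_le_wt v j : `|v ord0 j| <= wt v.
Proof.
apply: le_trans (coord_le_enorm v j) _.
by rewrite ler_wsqrtr // lerDr.
Qed.

Lemma wt_lipschitz p q : `|wt p - wt q| <= n%:R * enorm (p - q).
Proof.
have s0 : 0 < wt p + wt q by rewrite addr_gt0 ?wt_gt0.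
rewrite -(ler_pM2r s0) -[X in _ * X <= _](gtr0_norm s0) -normrM -subr_sqr.
rewrite !wt_sqr opprD addrACA subrr add0r /sqnorm -sumrB.
apply: le_trans (ler_norm_sum _ _ _) _.
rewrite -mulrA mulr_natl -[X in _ <= _ *+ X]card_ord -sumr_const.
apply: ler_sum => j _; rewrite subr_sqr normrM; apply: ler_pM => //.
  by have := coord_le_enorm (p - q) j; rewrite !mxE.
by apply: le_trans (ler_normD _ _) _; apply: lerD; exact: coord_le_wt.
Qed.

(** The map from gradients to horizontal components of unit normals is
    Lipschitz: this turns the integrability of [grad u - V] into that of
    [G - g]. *)
Lemma unit_slope_lipschitz p q j :
  `|p ord0 j / wt p - q ord0 j / wt q| <= n.+1%:R * enorm (p - q).
Proof.
have wp := wt_gt0 p; have wq := wt_gt0 q.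
have -> : p ord0 j / wt p - q ord0 j / wt q =
    (p ord0 j - q ord0 j) / wt p - (q ord0 j / wt q) * ((wt p - wt q) / wt p).
  by field; rewrite !gt_eqF.
have div_le (a : R) : `|a / wt p| <= `|a|.
  by rewrite normrM normfV (gtr0_norm wp) ler_pdivrMr // ler_peMr // wt_ge1.
apply: le_trans (ler_normB _ _) _; rewrite [n.+1%:R](_ : _ = 1 + n%:R); last by rewrite -natr1 addrC.
rewrite [leRHS]mulrDl mul1r; apply: lerD.
  apply: le_trans (div_le _) _.
  by have := coord_le_enorm (p - q) j; rewrite !mxE.
rewrite normrM -[leRHS]mul1r; apply: ler_pM => //.
  by rewrite normrM normfV (gtr0_norm wq) ler_pdivrMr // mul1r coord_le_wt.
by apply: le_trans (div_le _) _; exact: wt_lipschitz.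
Qed.

End lipschitz.

(** * The shape operator of a graph *)

Lemma scale_regE (R : pzRingType) (a b : R) : a *: (b : R^o) = a * b.
Proof. by []. Qed.

Lemma row_free_row_mx1 (F : fieldType) n m (A : 'M[F]_(n, m)) :
  row_free (row_mx 1%:M A).
Proof.
rewrite /row_free eqn_leq rank_leq_row /=.
have := mxrankM_maxl (row_mx 1%:M A) (col_mx (1%:M : 'M[F]_n) 0).
by rewrite mul_row_col mulmx1 mulmx0 addr0 mxrank1.
Qed.

Section jacobian.
Context {R : realType} {n m : nat}.

Lemma differentiable_row (V : normedModType R) (f : V -> 'rV[R]_m) (x : V) :
  (forall j, differentiable (fun y => f y ord0 j) x) -> differentiable f x.
Proof.
move=> df; have -> : f = \sum_j (fun y => f y ord0 j *: delta_mx ord0 j).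
  by apply/funext => y; rewrite fct_sumE; exact: row_sum_delta.
by apply: differentiable_sum => j; exact: differentiableZl.
Qed.

Lemma jacobian_coordE (f : 'rV[R]_n -> 'rV[R]_m) (x : 'rV[R]_n) i j :
  (forall j, differentiable (fun y => f y ord0 j) x) ->
  'J f x i j = 'D_(basis_vec i) (fun y => f y ord0 j) x.
Proof.
move=> df; have dx := differentiable_row df.
have := deriveEjacobian (basis_vec i) dx.
rewrite derive_mx; last exact: diff_derivable.
by rewrite /basis_vec -rowE => /rowP/(_ j); rewrite !mxE => <-.
Qed.

End jacobian.

Section graph.
Context {R : realType} {n : nat} (u : 'rV[R]_n -> R).
Hypothesis su : smooth u.
Notation e i := (basis_vec i : 'rV[R]_n).
Notation p x := (grad u x).
Notation W x := (Wfun u x).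
Implicit Types (x : 'rV[R]_n).

Lemma smooth_grad j : smooth (fun x => p x ord0 j).
Proof.
apply: (smooth_ext (f := fun x => 'D_(e j) u x)); last exact: smooth_derive.
by move=> x; rewrite mxE.
Qed.

Lemma hessE x i j : hess u x i j = 'D_(e i) (fun y => p y ord0 j) x.
Proof.
rewrite mxE; congr (derive _ _ _); apply/funext => y.
by rewrite [RHS]mxE.
Qed.

Lemma is_derive_grad x i j : is_derive x (e i) (fun y => p y ord0 j) (hess u x i j).
Proof. by rewrite hessE; apply: smooth_is_derive; exact: smooth_grad. Qed.

Lemma hess_sym x : (hess u x)^T = hess u x.
Proof. by apply/matrixP => i j; rewrite !mxE; exact: schwarz. Qed.

Lemma W_arg_gt0 x : 0 < 1 + sqnorm (p x).
Proof. by rewrite ltr_pwDl // sqnorm_ge0. Qed.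

Lemma W_gt0 x : 0 < W x. Proof. exact: wt_gt0. Qed.

Lemma W_neq0 x : W x != 0. Proof. by rewrite gt_eqF // W_gt0. Qed.

Lemma W_sqr x : W x ^+ 2 = 1 + sqnorm (p x). Proof. exact: wt_sqr. Qed.

Lemma smooth_W : smooth (fun x => W x).
Proof.
apply: smooth_sqrt; first exact: W_arg_gt0.
apply: smoothD; first exact: smooth_cst.
by apply: smooth_sum => j _; apply: (smoothM (smooth_grad j) (smooth_grad j)).
Qed.

Lemma smooth_Winv : smooth (fun x => (W x)^-1).
Proof. by apply: smoothV => [x|]; [exact: W_neq0|exact: smooth_W]. Qed.

Definition slope j x := p x ord0 j / W x.

Lemma smooth_slope j : smooth (slope j).
Proof. by apply: smoothM; [exact: smooth_grad|exact: smooth_Winv]. Qed.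

(** Half the derivative of [|grad u|^2] along the [i]-th axis. *)
Definition dsq x i := \sum_k p x ord0 k * hess u x i k.

Lemma derive_Winv x i : 'D_(e i) (fun y => (W y)^-1) x = - dsq x i / W x ^+ 3.
Proof.
have dW : is_derive x (e i) (fun y => W y) (dsq x i / W x).
  apply: DeriveDef; first by apply: smooth_derivable; exact: smooth_W.
  have h : is_derive x (e i) (fun y => 1 + sqnorm (p y)) (2 * dsq x i).
    have h1 : is_derive x (e i) (fun y => sqnorm (p y)) (2 * dsq x i).
      rewrite /dsq mulr_sumr; apply: is_derive_bigsum => k.
      apply: is_derive_eq (is_deriveX 2 (is_derive_grad x i k)) _.
      by rewrite expr1 scale_regE mulrA.
    by rewrite -[X in is_derive _ _ _ X]add0r; apply: is_deriveD.
  have df : differentiable (fun y => 1 + sqnorm (p y)) x.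
    apply: smooth_diff; apply: smoothD; first exact: smooth_cst.
    by apply: smooth_sum => j _; apply: (smoothM (smooth_grad j) (smooth_grad j)).
  have [_ ->] := diff_sqrt (f := fun y => 1 + sqnorm (p y)) (W_arg_gt0 x) df.
  by rewrite derive_val -/(W x); have := W_neq0 x; move: (W x) => w w0; field.
rewrite deriveV ?W_neq0 //.
rewrite derive_val scale_regE; have := W_neq0 x; move: (W x) => w w0.
by field.
Qed.

Lemma jac_slopeE x i j : jac slope x i j =
  hess u x i j / W x - dsq x i * p x ord0 j / W x ^+ 3.
Proof.
rewrite mxE.
have hW : is_derive x (e i) (fun y => (W y)^-1) (- dsq x i / W x ^+ 3).
  by rewrite -derive_Winv; apply: smooth_is_derive; exact: smooth_Winv.
rewrite (@derive_val _ _ _ _ _ _ _ (is_deriveM (is_derive_grad x i j) hW)).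
rewrite !scale_regE.
by have := W_neq0 x; move: (W x) => w w0; field.
Qed.

Lemma jacobian_graph_map x : 'J (graph_map u) x = row_mx 1%:M (p x)^T.
Proof.
have cE j : (fun y => graph_map u y ord0 j) =
    match fintype.split j with inl k => fun y => y ord0 k | inr _ => u end.
  apply/funext => y; rewrite mxE; case: (fintype.split j) => k //.
  by rewrite mxE (ord1 k) eqxx mulr1n.
have dc j : differentiable (fun y => graph_map u y ord0 j) x.
  rewrite cE; case: (fintype.split j) => k; first exact: differentiable_coord.
  exact: smooth_diff.
apply/matrixP => i j; rewrite jacobian_coordE // cE mxE.
case: (fintype.split j) => k; last by rewrite !mxE.
rewrite (@derive_val _ _ _ _ _ _ _ (is_derive_coord x (e i) k)) !mxE eqxx /=.
by rewrite eq_sym.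
Qed.

Lemma jacobian_normal x : 'J (normal u) x =
  row_mx (- jac slope x) (\col_i (- dsq x i / W x ^+ 3)).
Proof.
have cE j : (fun y => normal u y ord0 j) =
    match fintype.split j with inl k => fun y => - slope k y | inr _ => fun y => (W y)^-1 end.
  apply/funext => y; rewrite !mxE; case: (fintype.split j) => k.
    by rewrite mxE mulrN mulrC.
  by rewrite mxE (ord1 k) eqxx mulr1.
have dc j : differentiable (fun y => normal u y ord0 j) x.
  rewrite cE; case: (fintype.split j) => k; apply: smooth_diff; last exact: smooth_Winv.
  by apply: smoothN; exact: smooth_slope.
apply/matrixP => i j; rewrite jacobian_coordE // cE mxE.
case: (fintype.split j) => k; last by rewrite derive_Winv !mxE.
rewrite !mxE; apply: derive_val.
by apply: is_deriveN; apply: smooth_is_derive; exact: smooth_slope.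
Qed.

(** The first [n] coordinates of [- D_i N] are the [i]-th row of [jac slope],
    and those of the tangent vector [E_j] are the [j]-th vector of the standard
    basis; as [- D_i N] is tangent, its first [n] coordinates are its
    coordinates in the basis [E]. *)
Lemma shapeE x : Defs.shape u x = jac slope x.
Proof.
have -> : Defs.shape u x = jac slope x *m 'J (graph_map u) x *m pinvmx ('J (graph_map u) x).
  rewrite /Defs.shape; congr (_ *m _); rewrite jacobian_normal jacobian_graph_map.
  rewrite mul_mx_row mulmx1 opp_row_mx opprK; congr row_mx.
  apply/colP => i; rewrite !mxE mulNr opprK.
  under eq_bigr do rewrite jac_slopeE [(p x)^T _ _]mxE mulrBl.
  rewrite big_split sumrN /=.
  have -> : \sum_j hess u x i j / W x * p x ord0 j = dsq x i / W x.
    by rewrite /dsq mulr_suml; apply: eq_bigr => j _; rewrite mulrC mulrA.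
  have -> : \sum_j dsq x i * p x ord0 j / W x ^+ 3 * p x ord0 j =
      dsq x i / W x ^+ 3 * sqnorm (p x).
    by rewrite /sqnorm mulr_sumr; apply: eq_bigr => j _; ring.
  have -> : sqnorm (p x) = W x ^+ 2 - 1 by rewrite W_sqr addrC addKr.
  by have := W_neq0 x; move: (W x) => w w0; field.
by apply: mulmxKp; rewrite jacobian_graph_map row_free_row_mx1.
Qed.

Definition grad_tensor x : 'M[R]_n := (p x)^T *m p x.

(** The positive square root of the inverse [I - p^T p / W^2] of the induced
    metric [I + p^T p]: its eigenvalue is [1 / W] on the line spanned by [p] and
    [1] on the orthogonal complement. *)
Definition inv_metric_root x : 'M[R]_n := 1%:M - (W x * (W x + 1))^-1 *: grad_tensor x.

Lemma grad_tensor_sqr x : grad_tensor x *m grad_tensor x = (W x ^+ 2 - 1) *: grad_tensor x.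
Proof.
rewrite /grad_tensor -mulmxA [p x *m (_ *m _)]mulmxA.
have -> : p x *m (p x)^T = (W x ^+ 2 - 1)%:M.
  apply/matrixP => i j; rewrite !ord1 !mxE eqxx mulr1n W_sqr addrC addKr.
  by apply: eq_bigr => k _; rewrite !mxE expr2.
by rewrite mul_scalar_mx -scalemxAr.
Qed.

Lemma W1_neq0 x : W x + 1 != 0.
Proof. by rewrite gt_eqF // addr_gt0 // W_gt0. Qed.

Lemma inv_metric_root_unit x : inv_metric_root x \in unitmx.
Proof.
have W0 := W_neq0 x; have W1 := W1_neq0 x.
suff E : inv_metric_root x *m (1%:M + (W x + 1)^-1 *: grad_tensor x) = 1%:M.
  by case: (mulmx1_unit E).
rewrite mulmxDr mulmx1 -scalemxAr mulmxBl mul1mx -scalemxAl grad_tensor_sqr scalerA.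
rewrite /inv_metric_root -addrA -[RHS]addr0; congr (_ + _).
rewrite scalerBr scalerA -scaleNr -scaleNr -!scalerDl.
rewrite [X in X *: _](_ : _ = 0) ?scale0r //.
by move: (W x) W0 W1 => w w0 w1; field; rewrite w0 w1.
Qed.

Lemma jac_slope_factor x :
  jac slope x = (W x)^-1 *: (hess u x *m inv_metric_root x *m inv_metric_root x).
Proof.
have -> : hess u x *m inv_metric_root x *m inv_metric_root x =
    hess u x - (W x ^+ 2)^-1 *: (hess u x *m grad_tensor x).
  rewrite -mulmxA.
  have -> : inv_metric_root x *m inv_metric_root x = 1%:M - (W x ^+ 2)^-1 *: grad_tensor x.
    rewrite {2}/inv_metric_root mulmxBr mulmx1 -scalemxAr mulmxBl mul1mx.
    rewrite -scalemxAl grad_tensor_sqr scalerA.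
    rewrite /inv_metric_root -addrA; congr (_ + _).
    have W0 := W_neq0 x; have W1 := W1_neq0 x.
    apply/matrixP => i j; rewrite !mxE; move: (grad_tensor x i j) (W x) W0 W1 => q w w0 w1.
    by field; rewrite w0 w1.
  by rewrite mulmxBr mulmx1 -scalemxAr.
apply/matrixP => i j.
have E a b (X Y : 'M[R]_n) : (a *: (X - b *: Y)) i j = a * (X i j - b * Y i j).
  by rewrite !mxE.
rewrite jac_slopeE E.
have -> : (hess u x *m grad_tensor x) i j = dsq x i * p x ord0 j.
  rewrite mxE /dsq mulr_suml; apply: eq_bigr => k _.
  rewrite [grad_tensor x k j]mxE big_ord1 [(p x)^T _ _]mxE; ring.
by have := W_neq0 x; move: (W x) => w w0; field.
Qed.

Definition sym_shape x : 'M[R]_n :=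
  (W x)^-1 *: (inv_metric_root x *m hess u x *m inv_metric_root x).

Lemma inv_metric_root_sym x : (inv_metric_root x)^T = inv_metric_root x.
Proof. by rewrite /inv_metric_root /grad_tensor linearB /= trmx1 linearZ /= trmx_mul trmxK. Qed.

Lemma sym_shape_sym x : (sym_shape x)^T = sym_shape x.
Proof. by rewrite /sym_shape linearZ /= !trmx_mul inv_metric_root_sym hess_sym // mulmxA. Qed.

Lemma shape_conj_sym x : inv_metric_root x *m jac slope x = sym_shape x *m inv_metric_root x.
Proof. by rewrite jac_slope_factor /sym_shape -scalemxAr -scalemxAl !mulmxA. Qed.

Lemma slope_spectrum x : exists l : n.-tuple R,
  is_spectrum (jac slope x) l /\
  (\rank (jac slope x) <= count (predC1 0%R) l)%N.
Proof.
have [l [hl rl]] := symmetric_spectrum (sym_shape_sym x).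
exists l; split; first rewrite /is_spectrum.
  by rewrite (char_poly_similar (inv_metric_root_unit x) (shape_conj_sym x)).
apply: leq_trans rl.
rewrite -(mxrankMfree (sym_shape x) (_ : row_free (inv_metric_root x))); last first.
  by rewrite row_free_unit inv_metric_root_unit.
rewrite -shape_conj_sym -{1}[jac slope x]mul1mx -(mulVmx (inv_metric_root_unit x)) -mulmxA.
exact: mxrankM_maxr.
Qed.

Lemma principal_curvaturesP x : is_spectrum (jac slope x) (principal_curvatures u x).
Proof.
rewrite /principal_curvatures shapeE.
have [l [hl _]] := slope_spectrum x.
exact: (xgetPex _ (ex_intro _ l hl)).
Qed.

Lemma char_poly_coef_S x k : (k <= n)%N ->
  (char_poly (jac slope x))`_(n - k) = (-1) ^+ k * S_ u k x.
Proof.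
move=> kn; rewrite (principal_curvaturesP x) /S_ /Defs.esym.
move: (principal_curvatures u x) => [s sz]; have E := eqP sz; subst n => /=.
rewrite coef_prod_XsubC ?leq_subr // subKn //; congr (_ * _).
apply: eq_big => [I|I _]; first by rewrite inE.
by apply: eq_bigr => i _; rewrite (tnth_nth 0).
Qed.

(** The coefficients of degree [n - r - 1] and [n - r - 2] of the characteristic
    polynomial vanish; for [r + 1 = n] only the first of them exists, and it is
    the constant one. *)
Lemma rank_shape_le x r : (r < n)%N -> S_ u r.+1 x = 0 -> S_ u r.+2 x = 0 ->
  (\rank (Defs.shape u x) <= r)%N.
Proof.
move=> rn S1 S2; rewrite shapeE; have [l [hl rl]] := slope_spectrum x.
apply: leq_trans rl _; apply: (count_nonzero_real_rooted (n := n)) => //.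
- exact: size_tuple.
- by rewrite -hl char_poly_coef_S // S1 mulr0.
- by move=> r1n; rewrite -hl char_poly_coef_S // S2 mulr0.
Qed.

Lemma hess_eq0 x : Defs.shape u x = 0 -> hess u x = 0.
Proof.
rewrite shapeE jac_slope_factor => /eqP.
rewrite scaler_eq0 invr_eq0 (negbTE (W_neq0 x)) /= => /eqP.
have cancel (X : 'M[R]_n) : X *m inv_metric_root x = 0 -> X = 0.
  move=> /(congr1 (mulmx^~ (invmx (inv_metric_root x)))).
  by rewrite mulmxK ?inv_metric_root_unit // mul0mx.
by move=> /cancel/cancel.
Qed.

End graph.

(** * Vanishing of the symmetric functions of the curvatures *)

Section curvature.
Context {R : realType} {n : nat} (u : 'rV[R]_n -> R).
Hypothesis su : smooth u.
Variable c : R.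
Hypothesis hess_bound : forall x, hs_sqnorm (hess u x) <= c * (1 + sqnorm (grad u x)).

Lemma hess_entry_le x i j : `|hess u x i j| <= Num.sqrt c * Wfun u x.
Proof.
have W0 := W_gt0 u x.
have c0 : 0 <= c.
  rewrite -(pmulr_lge0 _ (W_arg_gt0 u x)); apply: le_trans (hess_bound x).
  by apply: sumr_ge0 => k _; apply: sumr_ge0 => l _; exact: sqr_ge0.
rewrite -(@ler_pXn2r _ 2) ?nnegrE ?mulr_ge0 ?sqrtr_ge0 // real_normK ?num_real //.
rewrite exprMn sqr_sqrtr // W_sqr; apply: le_trans (hess_bound x).
rewrite /hs_sqnorm (bigD1 i) //= (bigD1 j) //= -addrA lerDl addr_ge0 //.
  by apply: sumr_ge0 => k _; exact: sqr_ge0.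
by apply: sumr_ge0 => k _; apply: sumr_ge0 => l _; exact: sqr_ge0.
Qed.

Lemma jac_slope_le x i j : `|jac (slope u) x i j| <= n.+1%:R * Num.sqrt c.
Proof.
have W0 := W_gt0 u x; have Wn := W_neq0 u x.
have sc0 : 0 <= Num.sqrt c by exact: sqrtr_ge0.
rewrite jac_slopeE //; apply: le_trans (ler_normB _ _) _.
rewrite [n.+1%:R](_ : _ = 1 + n%:R); last by rewrite -natr1 addrC.
rewrite [leRHS]mulrDl mul1r; apply: lerD.
  by rewrite normrM normfV (gtr0_norm W0) ler_pdivrMr // hess_entry_le.
rewrite !normrM normfV normrX (gtr0_norm W0) ler_pdivrMr ?exprn_gt0 //.
rewrite exprS mulrCA expr2 mulrC; apply: ler_pM => //; first exact: coord_le_wt.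
apply: le_trans (ler_norm_sum _ _ _) _.
rewrite -!mulrA mulr_natl -[X in _ <= _ *+ X]card_ord -sumr_const.
apply: ler_sum => k _; rewrite normrM mulrC mulrA; apply: ler_pM => //.
  exact: hess_entry_le.
exact: coord_le_wt.
Qed.

(** The constant vector subtracted from [G] is its value for the gradient
    [V]. *)
Lemma S_divergence (V : 'rV[R]_n) (k : 'I_n) : exists (X : 'I_n -> 'rV[R]_n -> R) (C : R),
    [/\ forall i, smooth (X i),
        forall x i, `|X i x| <= C * enorm (grad u x - V) &
        forall x, divergence X x = k.+1%:R * S_ u k.+1 x].
Proof.
have [X [C [sX hX dX]]] := @esym_divergence R n (slope u) (fun j => V ord0 j / wt V)
  (smooth_slope su) (n.+1%:R * Num.sqrt c) (principal_curvatures u) k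
  jac_slope_le (principal_curvaturesP su).
exists X, (`|C| * (n%:R * n.+1%:R)); split=> // x i.
apply: le_trans (hX x i) _; apply: (@le_trans _ _ (`|C| * \sum_j `|slope u j x - V ord0 j / wt V|)).
  by rewrite ler_wpM2r ?ler_norm // sumr_ge0.
rewrite -!mulrA ler_wpM2l // mulr_natl -[X in _ <= _ *+ X]card_ord -sumr_const.
by apply: ler_sum => j _; exact: unit_slope_lipschitz.
Qed.

Lemma S_eq0 (V : 'rV[R]_n) k : L1_Rn (fun x => enorm (grad u x - V)) ->
  no_sign_change (S_ u k.+1) -> forall x, S_ u k.+1 x = 0.
Proof.
move=> grad_L1; have [nk|kn] := leqP n k.
  move=> _ x; rewrite /S_ /Defs.esym big1 // => I /eqP cI.
  by have := max_card (mem I); rewrite cI card_ord leqNgt ltnS nk.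
have [X [C [sX hX dX]]] := S_divergence V (Ordinal kn).
have h0 x : 0 <= enorm (grad u x - V) by exact: sqrtr_ge0.
have k0 : k.+1%:R != 0 :> R by rewrite pnatr_eq0.
move=> [Spos|Sneg] x; apply: (mulfI k0); rewrite mulr0 -[LHS]dX.
  apply: (divergence_eq0 sX grad_L1 h0 hX) => y.
  by rewrite dX mulr_ge0.
have dN y : divergence (fun i z => - X i z) y = - divergence X y.
  rewrite /divergence -sumrN; apply: eq_bigr => i _; apply: derive_val.
  by apply: is_deriveN; exact: smooth_is_derive.
apply/eqP; rewrite -oppr_eq0 -dN; apply/eqP.
apply: (divergence_eq0 _ grad_L1 h0 (C := C)) => [i|y i|y].
- exact: smoothN.
- by rewrite normrN.
- by rewrite dN dX oppr_ge0 mulr_ge0_le0.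
Qed.

(** The principal curvatures are only chosen pointwise, but their symmetric
    functions are divergences of smooth fields. *)
Lemma S_continuous k : (k < n)%N -> continuous (S_ u k.+1).
Proof.
move=> kn; have [X [C [sX _ dX]]] := S_divergence 0 (Ordinal kn).
have k0 : k.+1%:R != 0 :> R by rewrite pnatr_eq0.
have -> : S_ u k.+1 = fun x => k.+1%:R^-1 * divergence X x.
  by apply/funext => x; rewrite dX mulKf.
apply: smooth_cont; apply: smoothM; first exact: smooth_cst.
by apply: smooth_sum => i _; exact: smooth_derive.
Qed.

End curvature.

Lemma no_sign_change_neq0 (R : realType) n (f : 'rV[R]_n -> R) :
  continuous f -> (forall x, f x != 0) -> no_sign_change f.
Proof.
move=> cf f0; have [h|/existsNP[x /negP]] := pselect (forall x, 0 <= f x); first by left.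
rewrite -ltNge => fx; right=> y; rewrite leNgt; apply/negP => fy.
have [s _ fs] : exists2 s, s \in `[0, 1] & f (x + s *: (y - x)) = 0.
  apply: (IVT ler01); first exact/continuous_subspaceT/cont_line.
  rewrite scale0r addr0 scale1r addrC subrK.
  by rewrite ge_min le_max !(ltW fx) !(ltW fy) orbT.
by have := f0 (x + s *: (y - x)); rewrite fs eqxx.
Qed.

(** * Graphs of affine functions *)

Section constant.
Context {R : realType} {n : nat}.
Notation e i := (basis_vec i : 'rV[R]_n).

Lemma derive_coords (f : 'rV[R]_n -> R) (x v : 'rV[R]_n) : differentiable f x ->
  'D_v f x = \sum_j v ord0 j * 'D_(e j) f x.
Proof.
move=> df; rewrite deriveE // {1}[v]row_sum_delta linear_sum; apply: eq_bigr => j _.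
by rewrite linearZ deriveE.
Qed.

Lemma smooth_constant (f : 'rV[R]_n -> R) : smooth f ->
  (forall x j, 'D_(e j) f x = 0) -> forall x, f x = f 0.
Proof.
move=> sf Df x; have [c _] := MVT_line 0 x sf ltr01.
rewrite add0r scale1r mul1r derive_coords; last exact: smooth_diff.
rewrite big1 => [/eqP|j _]; first by rewrite subr_eq0 => /eqP.
by rewrite Df mulr0.
Qed.

Lemma affine_of_hess0 (u : 'rV[R]_n -> R) : smooth u -> (forall x, hess u x = 0) ->
  exists a : 'rV[R]_n, forall x, u x = u 0 + \sum_j x ord0 j * a ord0 j.
Proof.
move=> su H0; have g0 j x : grad u x ord0 j = grad u 0 ord0 j.
  apply: (smooth_constant (smooth_grad su j)) => y i.
  by rewrite -hessE H0 mxE.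
pose a := grad u 0; exists a => x.
have sl : smooth (fun x : 'rV[R]_n => \sum_j x ord0 j * a ord0 j).
  by apply: smooth_sum => j _; apply: smoothM; [exact: smooth_coord|exact: smooth_cst].
have := @smooth_constant (fun x => u x - \sum_j x ord0 j * a ord0 j) _ _ x.
rewrite [X in _ = _ - X]big1 => [|j _]; last by rewrite mxE mul0r.
rewrite subr0 => <- //; first by rewrite subrK.
  by apply: smoothD => //; exact: smoothN.
move=> y i; have hl : is_derive y (e i) (fun x : 'rV[R]_n => \sum_j x ord0 j * a ord0 j)
    (\sum_j a ord0 j * (e i) ord0 j).
  apply: is_derive_bigsum => j.
  have h := is_deriveM (is_derive_coord y (e i) j) (is_derive_cst (a ord0 j) y (e i)).
  by apply: is_derive_eq h _; rewrite scaler0 add0r.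
rewrite (@derive_val _ _ _ _ _ _ _ (is_deriveB (smooth_is_derive _ _ su) hl)).
have eE j : (e i) ord0 j = (j == i)%:R by rewrite mxE eqxx.
rewrite (bigD1 i) //= big1 => [|j /negbTE ji]; last by rewrite eE ji mulr0.
rewrite eE eqxx mulr1 addr0 /a -(g0 i y) [grad u y _ _]mxE; exact: subrr.
Qed.

End constant.

Section linear.
Context {R : realType} {n : nat}.

(** The derivatives of a linear map along a vector are constant, so only the
    first two steps of the recursion are not trivial. *)
Lemma Ck_mulmxr m (M : 'M[R]_(n, m)) (U : set 'rV[R]_n) k :
  Ck_on k U (fun y : 'rV[R]_n => y *m M).
Proof.
have cE j : (fun y : 'rV[R]_n => (y *m M) ord0 j) = fun y => \sum_k y ord0 k * M k j.
  by apply/funext => y; rewrite mxE.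
have df x : differentiable (fun y : 'rV[R]_n => y *m M) x.
  apply: differentiable_row => j; rewrite cE; apply: smooth_diff.
  by apply: smooth_sum => l _; apply: smoothM; [exact: smooth_coord|exact: smooth_cst].
case: k => [x _|k]; first exact: differentiable_continuous.
split=> [x _|v]; first exact: df.
have -> : (fun x : 'rV[R]_n => 'D_v (fun y : 'rV[R]_n => y *m M) x) = cst (v *m M).
  apply/funext => x; rewrite derive_mx; last exact: diff_derivable.
  apply/rowP => j; rewrite !mxE cE; apply: derive_val.
  apply: is_derive_bigsum => l.
  have h := is_deriveM (is_derive_coord x v l) (is_derive_cst (M l j) x v).
  by apply: is_derive_eq h _; rewrite scaler0 add0r; exact: mulrC.
elim: k (v *m M) => [|k IH] w; first by move=> x _; exact: cst_continuous.
split=> [x _|v']; first exact: differentiable_cst.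
have -> : (fun x : 'rV[R]_n => 'D_v' (cst w) x) = cst 0.
  by apply/funext => x; rewrite derive_cst.
exact: IH.
Qed.

End linear.

Section foliation.
Context {R : realType} {n : nat} (u : 'rV[R]_n -> R).

(** The chart is the identity: the transverse dimension [q] is zero, and [T] and
    [T'] only identify ['rV_n] with ['rV_(n + 0)].  The equality [q = 0] is a
    hypothesis because [q] is of the form [n - n] below. *)
Lemma flat_chart_graph q x0 : q = 0%N -> flat_chart u n q [set graph u] x0.
Proof.
move=> ->.
pose T : 'M[R]_(n, n + 0) := row_mx 1%:M 0.
pose T' : 'M[R]_(n + 0, n) := col_mx 1%:M 0.
have TT' : T *m T' = 1%:M by rewrite mul_row_col mulmx1 mul0mx addr0.
have T'T : T' *m T = 1%:M.
  rewrite mul_col_row !mulmx0 mul0mx mulmx1 [RHS]scalar_mx_block; congr block_mx.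
  exact: etrans (flatmx0 _) (esym (flatmx0 _)).
exists (open_box (x0 - const_mx 1) (x0 + const_mx 1)).
exists ((x0 - const_mx 1) *m T), ((x0 + const_mx 1) *m T).
exists (fun x => x *m T), (fun y => y *m T').
have TE (x : 'rV[R]_n) (i : 'I_n) : (x *m T) ord0 (lshift 0 i) = x ord0 i.
  by rewrite mul_mx_row mulmx1 row_mxEl.
split.
- split; last by move=> i; rewrite !mxE; apply/andP; split; lra.
  have -> : open_box (x0 - const_mx 1) (x0 + const_mx 1) = ball x0 1.
    apply/seteqP; split=> [y h|y [_ h] i].
      split=> // i j; rewrite ord1; have := h j; rewrite !mxE /ball /= ltr_norml.
      by case/andP=> *; apply/andP; split; lra.
    have := h ord0 i; rewrite !mxE /ball /= ltr_norml.
    by case/andP=> *; apply/andP; split; lra.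
  exact: ball_open.
- split=> [|x _]; last by rewrite -mulmxA TT' mulmx1.
  apply/seteqP; split=> [_ [x h <-] i|y h].
    case: (fintype.splitP i) => [j ij|[] //].
    have -> : i = lshift 0 j by exact: val_inj.
    by rewrite !TE; exact: h.
  exists (y *m T'); last by rewrite -mulmxA T'T mulmx1.
  move=> i; have := h (lshift 0 i); rewrite !TE.
  by rewrite -(TE (y *m T') i) -mulmxA T'T mulmx1.
- by split=> k; exact: Ck_mulmxr.
move=> L ->; exists setT; split.
  apply: (sub_countable _ (countable1 (0 : 'rV[R]_0))).
  by apply: subset_card_le => v _; rewrite /= [v]thinmx0.
apply/seteqP; split=> x [Ux _]; split=> //.
by exists x.
Qed.

Lemma foliated_of_affine (a : 'rV[R]_n) d : d = n ->
  (forall x, u x = u 0 + \sum_j x ord0 j * a ord0 j) -> foliated_by_affine u d.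
Proof.
move=> -> ua; exists [set graph u]; split.
- move=> L ->; exists (graph_map u 0), (row_mx 1%:M a^T); split; first exact: row_free_row_mx1.
  have E x : graph_map u 0 + x *m row_mx 1%:M a^T = graph_map u x.
    rewrite /graph_map mul_mx_row mulmx1 add_row_mx add0r; congr row_mx.
    apply/matrixP => i j; rewrite !ord1 !mxE eqxx !mulr1n [in RHS]ua; congr (_ + _).
    by apply: eq_bigr => k _; rewrite mxE.
  by apply/seteqP; split=> [_ [x _ <-]|_ [x _ <-]]; exists x.
- by rewrite bigcup_set1.
- by move=> A B -> ->.
- by move=> x0; apply: flat_chart_graph; exact: subnn.
Qed.

End foliation.

(** * Relative nullity and the foliation *)

Theorem theorem1 (R : realType) (n : nat) (u : 'rV[R]_n -> R)
  (u_smooth : smooth_on [set: 'rV[R]_n] u)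
  (V : 'rV[R]_n)
  (grad_L1 : L1_Rn (fun x => enorm (grad u x - V)))
  (c : R) (c_gt0 : 0 < c)
  (hess_bound : forall x, hs_sqnorm (hess u x) <= c * (1 + sqnorm (grad u x)))
  (r : nat) (r_lt_n : (r < n)%N)
  (S_r1 : no_sign_change (S_ u r.+1))
  (S_r2 : no_sign_change (S_ u r.+2)) :
  (forall x, (n - r <= relative_nullity u x)%N) /\
  ((forall x, S_ u r x != 0) -> foliated_by_affine u (n - r)).
Proof.
have rank_le x : (\rank (Defs.shape u x) <= r)%N.
  by apply: rank_shape_le => //; apply: (S_eq0 u_smooth hess_bound grad_L1).
split=> [x|]; first by rewrite /relative_nullity mxrank_ker leq_sub2l.
case: r => [|r] in r_lt_n S_r1 S_r2 rank_le *; last first.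
  move=> S0.
  have h := no_sign_change_neq0 (S_continuous u_smooth hess_bound (ltnW r_lt_n)) S0.
  by have := S0 0; rewrite (S_eq0 u_smooth hess_bound grad_L1 h) eqxx.
move=> _; have H0 x : hess u x = 0.
  apply: (hess_eq0 u_smooth); apply/eqP; rewrite -mxrank_eq0 -leqn0.
  exact: rank_le.
have [a ua] := affine_of_hess0 u_smooth H0.
by apply: foliated_of_affine ua; rewrite subn0.
Qed.
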